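(* Let $G$ be a $d$-regular graph of size $n$, and let $\{A_t\}_{t\ge0}$ be a $G$-Cylinder-DLA process. Let $D=D_\infty$ be its density at infinity, and for all $m\in\mathbb N$ let $T_m=\min\{t\ge0: A_t\cap G_m\neq\emptyset\}$. Then $$D=\lim_{m\to\infty}\frac1{mn}\mathbf E[T_m].$$
   Context: Graphs $G$ are finite, simple and connected; size means number of vertices. $\mathbb N=\{0,1,2,\dots\}$. Cylinder: $G\times\mathbb N$ has vertex set $V(G)\times\mathbb N$, with $(u,m)\sim(v,k)$ iff either $m=k$ and $u\sim v$, or $|m-k|=1$ and $u=v$. The $i$-th layer is $G_i=V(G)\times\{i\}$. For a set $A$ of vertices of $G\times\mathbb N$, $\partial A$ is the set of vertices not in $A$ that are adjacent to some vertex of $A$. $G$-Cylinder-DLA process: a random increasing sequence $(A_t)_{t\ge 0}$ of vertex sets with $A_0=G_0$. Given $A_0,\dots,A_t$, put $M(t)=\min\{i\in\mathbb N: G_i\cap A_t=\emptyset\}$ and let $(g_{t+1}(r),\zeta_{t+1}(r))_{r\ge0}$ be a simple random walk on $G\times\mathbb N$ (each step goes to a uniformly random neighbour) with $g_{t+1}(0)$ uniform on $V(G)$ and $\zeta_{t+1}(0)=M(t)$. Let $\kappa(t+1)=\min\{r\ge0:(g_{t+1}(r),\zeta_{t+1}(r))\in\partial A_t\}$ (a.s. finite) and $A_{t+1}=A_t\cup\{(g_{t+1}(\kappa(t+1)),\zeta_{t+1}(\kappa(t+1)))\}$. Density: $A_\infty=\bigcup_{t\ge0}A_t$; $D(m)=\frac1{mn}\sum_{i=1}^m|A_\infty\cap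 G_i|$; the density at infinity is $D=D_\infty=\lim_{m\to\infty}D(m)$. By standard ergodic arguments this limit exists and is almost surely constant, so $D$ is regarded as a number, and $D=\lim_{m\to\infty}\mathbf E[D(m)]$. *)

(* Defs.v *)
From HB Require Import structures.
From mathcomp Require Import all_boot all_order all_algebra finmap.
From mathcomp Require Import all_classical all_reals all_analysis.

Set Implicit Arguments.
Unset Strict Implicit.
Unset Printing Implicit Defensive.

Import Order.TTheory GRing.Theory Num.Theory.
Import numFieldNormedType.Exports.

Local Open Scope classical_set_scope.
Local Open Scope ring_scope.

(** A graph is an adjacency relation [e : rel V] on a finite type [V]. *)

Record simple_connected_graph (V : finType) (e : rel V) : Prop := {
  graph_sym : symmetric e ;
  graph_irrefl : irreflexive e ;
  graph_connected : forall u v : V, connect e u v }.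

Definition regular_graph (V : finType) (e : rel V) (d : nat) : Prop :=
  forall v : V, #|e v| = d.

Definition cyl_adj (V : finType) (e : rel V) : rel (V * nat) :=
  fun x y => ((x.2 == y.2) && e x.1 y.1)
          || ((x.1 == y.1) && ((y.2 == x.2.+1) || (x.2 == y.2.+1))).

Definition layer (V : finType) (i : nat) : set (V * nat) :=
  [set x | x.2 = i].
Arguments layer : clear implicits.

Definition boundary (V : finType) (e : rel V) (A : set (V * nat)) :
    set (V * nat) :=
  [set x | ~ A x /\ exists2 y, A y & cyl_adj e x y].

(** [least S] is the singleton of the minimum of [S], or is empty if [S] is. *)
Definition least (S : set nat) : set nat :=
  [set k | S k /\ forall j, S j -> (k <= j)%N].

(** [fset_set] is only meaningful on finite sets; see [finite_nbrs] and
    [finite_layer] below. *)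
Definition set_card (X : choiceType) (S : set X) : nat := #|` fset_set S|.

Definition nbrs (V : finType) (e : rel V) (x : V * nat) : set (V * nat) :=
  [set y | cyl_adj e x y].

Lemma finite_layer (V : finType) (i : nat) : finite_set (layer V i).
Proof.
have : finite_set ((fun v : V => (v, i)) @` setT).
  by apply: finite_image; exact: finite_finset.
by apply: sub_finite_set => -[v j]; rewrite /layer /= => ->; exists v.
Qed.

Lemma finite_nbrs (V : finType) (e : rel V) (x : V * nat) :
  finite_set (nbrs e x).
Proof.
have : finite_set (layer V x.2 `|` layer V x.2.+1 `|` layer V x.2.-1).
  by rewrite !finite_setU; do ![split]; exact: finite_layer.
apply: sub_finite_set => y /orP[/andP[/eqP xy _]|/andP[_ /orP[]/eqP xy]].
- by left; left; rewrite /layer /= xy.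
- by left; right.
- by right; rewrite /layer /= xy.
Qed.

Definition step_prob (R : realType) (V : finType) (e : rel V)
    (x y : V * nat) : R :=
  if cyl_adj e x y then (set_card (nbrs e x))%:R^-1 else 0.

(** The set [{M}] where [M] is the index of the first layer not meeting [A]. *)
Definition first_empty_layer (V : finType) (A : set (V * nat)) : set nat :=
  least [set i | layer V i `&` A = set0].

(** Probability that the first [k] steps of the walk released from the first
    empty layer of [A] follow the path [x 0, ..., x k]. *)
Definition walk_prob (R : realType) (V : finType) (e : rel V)
    (A : set (V * nat)) (x : nat -> V * nat) (k : nat) : R :=
  ((x 0%N).2 \in first_empty_layer A)%:R * (#|V|%:R)^-1
  * \prod_(i < k) step_prob R e (x i) (x i.+1).

(** [A t] is the aggregate at time [t] and [W t r] the position at time [r] of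
    the particle [(g_t, zeta_t)], which is used only for [t > 0].
    In [dla_walk], [a] ranges over histories of the aggregate.  As [A t] is
    always a finite set there are only countably many histories, so the
    conditional law of the walk given [A 0, ..., A t] is determined by
    conditioning on each of them.  In [dla_step], the image is the singleton of
    the point where the walk first hits the boundary; nothing is added on the
    null event that it never does. *)
Record cylinder_DLA (d : measure_display) (Omega : measurableType d)
    (R : realType) (P : probability Omega R) (V : finType) (e : rel V)
    (A : nat -> Omega -> set (V * nat))
    (W : nat -> nat -> Omega -> V * nat) : Prop := {
  dla_measurable : forall t r x, measurable [set w | W t.+1 r w = x] ;
  dla_start : forall w, A 0%N w = layer V 0 ;
  dla_walk : forall (t k : nat) (a : nat -> set (V * nat))
      (x : nat -> V * nat),
    P ([set w | forall s, (s <= t)%N -> A s w = a s] `&`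
       [set w | forall r, (r <= k)%N -> W t.+1 r w = x r])
    = (P [set w | forall s, (s <= t)%N -> A s w = a s]
       * (walk_prob R e (a t) x k)%:E)%E ;
  dla_step : forall t w,
    A t.+1 w = A t w `|`
      [set W t.+1 k w |
        k in least [set r | boundary e (A t w) (W t.+1 r w)]] }.

Definition final_aggregate (Omega : Type) (V : finType)
    (A : nat -> Omega -> set (V * nat)) (w : Omega) : set (V * nat) :=
  \bigcup_t A t w.

Definition density (R : realType) (Omega : Type) (V : finType)
    (A : nat -> Omega -> set (V * nat)) (m : nat) (w : Omega) : R :=
  ((m * #|V|)%N%:R)^-1 *
  \sum_(1 <= i < m.+1) (set_card (final_aggregate A w `&` layer V i))%:R.

Definition density_at_infinity (d : measure_display)
    (Omega : measurableType d) (R : realType) (P : probability Omega R)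
    (V : finType) (A : nat -> Omega -> set (V * nat)) (D : R) : Prop :=
  {ae P, forall w, density R A m w @[m --> \oo] --> D}.

(** The minimum is taken in the extended reals: it is [+oo] when [A] never
    reaches layer [m]. *)
Definition reach_time (R : realType) (Omega : Type) (V : finType)
    (A : nat -> Omega -> set (V * nat)) (m : nat) (w : Omega) : \bar R :=
  ereal_inf [set (t%:R)%:E | t in [set t | A t w `&` layer V m !=set0]].

(* Main.v *)
Require Import Defs.
From HB Require Import structures.
From mathcomp Require Import all_boot all_order all_algebra finmap.
From mathcomp Require Import all_classical all_reals all_analysis.
From mathcomp Require Import measurable_realfun ring lra.

Set Implicit Arguments.
Unset Strict Implicit.
Unset Printing Implicit Defensive.

Import Order.TTheory GRing.Theory Num.Theory.
Import numFieldNormedType.Exports.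

Local Open Scope classical_set_scope.
Local Open Scope ring_scope.

(** Let [S_m] be the number of vertices of the final aggregate in the layers
    [1, ..., m], so that [S_m = m n D(m)].  The theorem says that [S_m] and
    [T_m] have asymptotically the same mean, and the proof shows more:
    [0 <= E S_m - E T_m <= C] for a constant [C] that depends on [G] only.

    Until time [T_m] all particles stick in the layers [1, ..., m], one at each
    step because a walk almost surely reaches the boundary; hence [T_m <= S_m]
    ([time_le_count]).  Conversely, what [S_m] has in excess of [T_m] is due to
    the particles released above layer [m] that nevertheless land in a layer
    at most [m] ([count_le_time]).  A particle released from layer [M] has to
    cross all the layers between [m] and [M], each of which holds a vertex of
    the aggregate, and in each it sticks with a probability bounded below: so
    it gets down to [m] with probability at most [rho ^ (M - 1 - m)], for some
    [rho < 1] ([history_lands_low]).  On the other hand a particle released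
    from [M] starts right above an aggregate vertex with probability at least
    [1 / n], and then the height increases; so the mean number of particles
    released from [M] is at most [n] ([expected_time_at_height]).  The mean
    excess is therefore at most [n] times a geometric series
    ([sum_late_low]).  Since [D(m)] is bounded and tends to [D] almost surely,
    [E D(m)] tends to [D], and dividing by [m n] gives the claim.

    The hypotheses on the walk are probabilities of finite paths.  So the two
    estimates about one particle, how deep it goes and that it sticks at all,
    are not drawn from a theory of Markov chains but from explicit functions
    that are superharmonic off the aggregate ([descent], [survival]), compared
    with the walk by induction on the number of remaining steps
    ([outcome_follows_le]).  Both functions rest on one estimate for the walk
    inside a single layer ([leave_le_bound]). *)

(** * Leaving a layer before meeting a set of vertices *)
Section Leaving.
Context (R : realType) (V : finType) (e : rel V) (d : nat).
Hypotheses (hG : simple_connected_graph e) (hd : regular_graph e d).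

(** The probability that the walk on the cylinder started at [v] in some layer
    does not meet [B] in that layer during its first [k] steps, when it counts
    as escaped once it takes one of the two vertical steps. *)
Fixpoint leave (B : pred V) (k : nat) (v : V) : R :=
  if k is k'.+1 then
    if B v then 0 else (\sum_(u in e v) leave B k' u + 2) / d.+2%:R
  else 1.

Lemma leaveS B k v : leave B k.+1 v =
  if B v then 0 else (\sum_(u in e v) leave B k u + 2) / d.+2%:R.
Proof. by []. Qed.

Definition leave_bound : R := 1 - d.+2%:R^-1 ^+ #|V|.

Lemma sum_nbrs_const (c : R) v : \sum_(u in e v) c = c * d%:R.
Proof. by rewrite sumr_const hd mulr_natr. Qed.

Lemma leave_itv (B : pred V) k v : 0 <= leave B k v <= 1.
Proof.
elim: k v => [|k IH] v /=; first by rewrite ler01 lexx.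
case: (B v); first by rewrite lexx ler01.
have s0 : 0 <= \sum_(u in e v) leave B k u.
  by apply: sumr_ge0 => u _; case/andP: (IH u).
have s1 : \sum_(u in e v) leave B k u <= d%:R.
  rewrite -[leRHS]mul1r -(sum_nbrs_const 1 v); apply: ler_sum => u _.
  by case/andP: (IH u).
apply/andP; split; first by rewrite divr_ge0 ?ler0n // addr_ge0.
by rewrite ler_pdivrMr ?ltr0n // mul1r -(addn2 d) natrD lerD2r.
Qed.

(** Monotonicity in [k] is what turns the recursion for [leave] into the
    inequality [leave_super] with the same [k] on both sides. *)
Lemma leave_nincr (B : pred V) k v : leave B k.+1 v <= leave B k v.
Proof.
elim: k v => [|k IH] v; first by case/andP: (leave_itv B 1 v).
rewrite [leLHS]/= [leRHS]/=; case: (B v) => //.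
by rewrite ler_pM2r ?invr_gt0 ?ltr0n // lerD2r; apply: ler_sum => u _; exact: IH.
Qed.

Lemma leave_path (B : pred V) v p : path e v p -> B (last v p) ->
  leave B (size p).+1 v <= 1 - d.+2%:R^-1 ^+ (size p).+1.
Proof.
have c0 : (0 : R) < d.+2%:R^-1 by rewrite invr_gt0 ltr0n.
have c1 : d.+2%:R^-1 <= (1 : R) by rewrite invf_le1 ?ltr0n // ler1n.
elim: p v => [|u p IH] v.
  by move=> _ /= ->; rewrite expr1 subr_ge0.
rewrite [path _ _ _]/= [last _ _]/= [size _]/= => /andP[vu pp] Bp.
have {}IH := IH u pp Bp.
rewrite leaveS; case: (B v); first by rewrite subr_ge0 exprn_ile1 // ltW.
set k := (size p).+1 in IH *.
have : d.+2%:R^-1 ^+ k <= \sum_(w in e v) (1 - leave B k w).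
  rewrite (bigD1 u) //= ler_wpDr //; last by rewrite lerBrDr addrC -lerBrDr.
  by apply: sumr_ge0 => w _; rewrite subr_ge0; case/andP: (leave_itv B k w).
rewrite sumrB sum_nbrs_const mul1r => h.
rewrite ler_pdivrMr ?ltr0n // mulrBl mul1r exprS mulrAC mulVf ?pnatr_eq0 // mul1r.
rewrite -[X in _ <= X%:R - _](addn2 d) natrD.
lra.
Qed.

(** One way not to escape is to follow a simple path of the layer to [B]: it
    has fewer than [#|V|] edges, and each is taken with probability
    [1 / (d + 2)]. *)
Lemma leave_le_bound (B : pred V) v : (exists u, B u) -> leave B #|V| v <= leave_bound.
Proof.
case=> u Bu; have /connectP[q pq uq] := graph_connected hG v u.
case/shortenP: pq uq => p pp up _ uE.
have sp : (size p < #|V|)%N.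
  have := max_card (mem (v :: p)); rewrite (card_uniqP up) /=; exact.
have c0 : (0 : R) < d.+2%:R^-1 by rewrite invr_gt0 ltr0n.
have c1 : d.+2%:R^-1 <= (1 : R) by rewrite invf_le1 ?ltr0n // ler1n.
have decr i j : (i <= j)%N -> leave B j v <= leave B i v.
  elim: j => [|j IH]; first by rewrite leqn0 => /eqP->.
  rewrite leq_eqVlt ltnS => /predU1P[-> //|/IH]; apply: le_trans.
  exact: leave_nincr.
apply: (le_trans (decr _ _ sp)); apply: (le_trans (leave_path pp _)).
  by rewrite -uE.
by rewrite /leave_bound lerD2l lerN2 ler_wiXn2l // ltW.
Qed.

Lemma leave_super (B : pred V) k v : ~~ B v ->
  \sum_(u in e v) leave B k u + 2 <= d.+2%:R * leave B k v.
Proof.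
move=> /negbTE Bv; rewrite mulrC -ler_pdivrMr ?ltr0n //.
by have := leave_nincr B k v; rewrite [leLHS]/= Bv.
Qed.

Lemma leave_bound_itv : (0 < #|V|)%N -> 0 < leave_bound < 1.
Proof.
move=> V0; have c0 : (0 : R) < d.+2%:R^-1 by rewrite invr_gt0 ltr0n.
have c1 : d.+2%:R^-1 < (1 : R) by rewrite invf_lt1 ?ltr0n // ltr1n.
apply/andP; split; last by rewrite /leave_bound ltrBlDr ltrDl exprn_gt0.
by rewrite subr_gt0 exprn_ilt1 ?(ltW c0) // -lt0n V0.
Qed.

End Leaving.

(** * Neighbours on the cylinder *)
Lemma set_card_seq (X : choiceType) (S : set X) (s : seq X) :
  uniq s -> (forall x, x \in s <-> S x) -> set_card S = size s.
Proof.
move=> us sS; rewrite /set_card -(undup_id us) -card_fseq.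
congr #|` _|; rewrite -[RHS]set_fsetK; congr fset_set.
by apply/seteqP; split=> y /=; rewrite in_fset => /sS.
Qed.

Section Cylinder.
Context (V : finType) (e : rel V).

(** A duplicate-free enumeration, in which layer [0] has no lower neighbour. *)
Definition nbr_seq (x : V * nat) : seq (V * nat) :=
  (x.1, x.2.+1) :: (if x.2 is j.+1 then [:: (x.1, j)] else [::])
    ++ [seq (u, x.2) | u <- enum (e x.1)].

Lemma mem_nbr_seq x y : (y \in nbr_seq x) = cyl_adj e x y.
Proof.
case: x y => v j [u i]; rewrite /nbr_seq /cyl_adj in_cons mem_cat /=.
have -> : ((u, i) \in [seq (w, j) | w <- enum (e v)]) = (j == i) && e v u.
  apply/mapP/andP => [[w]|[/eqP <- vu]].
    by rewrite mem_enum => vw [-> ->].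
  by exists u; rewrite // mem_enum.
have -> : ((u, i) \in if j is k.+1 then [:: (v, k)] else [::])
          = (v == u) && (j == i.+1).
  case: j => [|j]; rewrite ?in_nil ?andbF // inE xpair_eqE eqSS.
  by rewrite (eq_sym u) (eq_sym i).
by rewrite xpair_eqE (eq_sym u) orbA -andb_orr orbC.
Qed.

Lemma nbr_seq_uniq x : uniq (nbr_seq x).
Proof.
case: x => v j; rewrite /nbr_seq /= cat_uniq.
rewrite map_inj_uniq ?enum_uniq; last by move=> ? ? [].
rewrite andbT mem_cat negb_or.
have h1 : (v, j.+1) \notin [seq (u, j) | u <- enum (e v)].
  by apply/mapP => -[w _ [_ /eqP]]; rewrite gtn_eqF.
rewrite h1 andbT; apply/and3P; split.
- by case: j {h1} => [|j] //; rewrite inE xpair_eqE (gtn_eqF (leqnSn j.+1)) andbF.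
- by case: j {h1}.
- case: j {h1} => [|j]; first by apply/hasPn => -[? ?] _; rewrite in_nil.
  by apply/hasPn => -[u i] /mapP[w _ [_ ->]]; rewrite inE xpair_eqE gtn_eqF ?andbF.
Qed.

Lemma set_card_nbrs x : set_card (nbrs e x) = size (nbr_seq x).
Proof.
by apply: set_card_seq (nbr_seq_uniq x) _ => y; rewrite mem_nbr_seq.
Qed.

Lemma sum_nbr_seq (R : realType) (f : V * nat -> R) v j :
  \sum_(y <- nbr_seq (v, j.+1)) f y =
  f (v, j.+2) + (f (v, j) + \sum_(u in e v) f (u, j.+1)).
Proof. by rewrite /nbr_seq /= !big_cons big_map big_enum. Qed.

Lemma size_nbr_seq d v j : regular_graph e d ->
  size (nbr_seq (v, j.+1)) = d.+2.
Proof. by move=> hd; rewrite /nbr_seq /= size_map -cardE hd. Qed.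

Lemma step_prob_nbr (R : realType) d x y : regular_graph e d ->
  (0 < x.2)%N -> y \in nbr_seq x -> step_prob R e x y = d.+2%:R^-1.
Proof.
case: x => v [|j] // hd _; rewrite /step_prob mem_nbr_seq => ->.
by rewrite set_card_nbrs (size_nbr_seq _ _ hd).
Qed.

End Cylinder.

(** * Superharmonic functions off the aggregate *)

(** Besides making [M] the first empty layer, this excludes vertices of [A]
    above it. *)
Definition has_height (V : finType) (A : set (V * nat)) (M : nat) : Prop :=
  (forall j, (j < M)%N -> exists v, A (v, j)) /\
  (forall x, A x -> (x.2 < M)%N).

Section Superharmonic.
Context (R : realType) (V : finType) (e : rel V) (d : nat).
Hypotheses (hG : simple_connected_graph e) (hd : regular_graph e d).
Context (A : set (V * nat)) (M : nat).
Hypotheses (V0 : (0 < #|V|)%N) (AM : has_height A M) (A0 : layer V 0 `<=` A).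

Local Notation gam := (leave_bound R V d).

Definition layer_leave (x : V * nat) : R :=
  leave R e d (fun u => `[< A (u, x.2) >]) #|V| x.1.

Lemma layer_leave_ge0 x : 0 <= layer_leave x.
Proof. by have /andP[] := leave_itv R hd (fun u => `[< A (u, x.2) >]) #|V| x.1. Qed.

Lemma layer_leave_le x : (x.2 < M)%N -> layer_leave x <= gam.
Proof.
move=> /(AM.1)[v Av]; apply: (leave_le_bound R hG hd).
by exists v; apply/asboolP.
Qed.

Lemma layer_leave_super v j : ~ A (v, j) ->
  \sum_(u in e v) layer_leave (u, j) + 2 <= d.+2%:R * layer_leave (v, j).
Proof.
move=> Av; apply: (@leave_super R V e d hd (fun u => `[< A (u, j) >]) #|V| v).
by apply/asboolPn.
Qed.

Let gam_gt0 : 0 < gam.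
Proof. by case/andP: (leave_bound_itv R d V0). Qed.

Let gam_lt1 : gam < 1.
Proof. by case/andP: (leave_bound_itv R d V0). Qed.

(** The solution of [1 + 1 / rho = 2 / gam].  With heights weighted by powers of
    [rho], the vertical neighbours of a vertex weigh at most [1] and [1 / rho]
    relative to it, and [2 / gam] is what [layer_leave_super] leaves for them
    once [layer_leave] is divided by its bound [gam]. *)
Definition descent_ratio : R := gam / (2 - gam).

Lemma descent_ratio_gt0 : 0 < descent_ratio.
Proof. by have := gam_gt0; have := gam_lt1 => *; rewrite divr_gt0 //; lra. Qed.

Lemma descent_ratio_lt1 : descent_ratio < 1.
Proof.
by have := gam_gt0; have := gam_lt1 => *; rewrite ltr_pdivrMr ?mul1r; lra.
Qed.

(** Bounds the probability that the walk from [x] gets down to layer [m] without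
    touching [A].  Every layer strictly between [m] and [M] costs a factor
    [descent_ratio]; the last factor vanishes on [A] and accounts for the
    position inside such a layer.  Above [M] the function is constant, since
    the walk comes back from there sooner or later. *)
Definition descent (m : nat) (x : V * nat) : R :=
  descent_ratio ^+ (minn x.2 M.-1 - m) *
  (if (m < x.2 < M)%N then layer_leave x / gam else 1).

Lemma descent_ge0 m x : 0 <= descent m x.
Proof.
rewrite mulr_ge0 ?exprn_ge0 ?(ltW descent_ratio_gt0) //.
by case: ifP => // _; rewrite divr_ge0 ?layer_leave_ge0 ?(ltW gam_gt0).
Qed.

Lemma descent_le m x : descent m x <= descent_ratio ^+ (minn x.2 M.-1 - m).
Proof.
rewrite -[leRHS]mulr1 ler_wpM2l ?exprn_ge0 ?(ltW descent_ratio_gt0) //.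
case: ifP => // /andP[_ xM]; rewrite ler_pdivrMr ?gam_gt0 // mul1r.
exact: layer_leave_le.
Qed.

Lemma descent_low m x : (x.2 <= m)%N -> descent m x = 1.
Proof.
move=> xm; rewrite /descent ltnNge xm /= mulr1.
have /eqP -> : (minn x.2 M.-1 - m)%N == 0%N.
  by rewrite subn_eq0 geq_min xm.
by rewrite expr0.
Qed.

Lemma descent_high m x : (M <= x.2)%N -> descent m x = descent_ratio ^+ (M.-1 - m).
Proof.
move=> xM; rewrite /descent (ltnNge x.2) xM andbF mulr1.
by congr (_ ^+ (_ - _)); apply/minn_idPr; exact: leq_trans (leq_pred _) xM.
Qed.

Let descent_ratio_mono i j : (i <= j)%N -> descent_ratio ^+ j <= descent_ratio ^+ i.
Proof.
by move=> ij; rewrite ler_wiXn2l ?(ltW descent_ratio_gt0) ?(ltW descent_ratio_lt1).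
Qed.

Lemma height_gt0 : (0 < M)%N.
Proof.
have /card_gt0P[v _] := V0.
exact: (AM.2 (v, 0%N)) (A0 _).
Qed.

Lemma notin_height x : ~ A x -> (0 < x.2)%N.
Proof. by move=> Ax; rewrite lt0n; apply/eqP => x0; apply: Ax; exact: A0. Qed.

(** Strictly between [m] and [M] this is [layer_leave_super], scaled; in the
    other layers the value at [x] is the largest one among its neighbours. *)
Lemma descent_super m x : (m < M)%N -> ~ A x ->
  \sum_(y <- nbr_seq e x) descent m y <= d.+2%:R * descent m x.
Proof.
move=> mM; case: x => v [|j] Ax; first by have := notin_height Ax.
(* The trivial case: no neighbour has a larger value. *)
have const c : (forall u i, (j <= i <= j.+2)%N -> descent m (u, i) <= c) ->
    \sum_(y <- nbr_seq e (v, j.+1)) descent m y <= d.+2%:R * c.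
  move=> hc; rewrite sum_nbr_seq -(addn2 d) natrD.
  have h1 : descent m (v, j.+2) <= c by apply: hc; rewrite leqnn (leqW (leqnSn j)).
  have h2 : descent m (v, j) <= c by apply: hc; rewrite leqnn (leqW (leqnSn j)).
  have h3 : \sum_(u in e v) descent m (u, j.+1) <= c * d%:R.
    rewrite -(sum_nbrs_const hd c v); apply: ler_sum => u _.
    by apply: hc; rewrite !leqnSn.
  lra.
have [jm|jm] := leqP j.+1 m.
  rewrite [descent m (v, _)]descent_low //; apply: const => u i _.
  apply: le_trans (descent_le _ _) _.
  by rewrite exprn_ile1 ?(ltW descent_ratio_gt0) ?(ltW descent_ratio_lt1).
have [Mj|jM] := leqP M j.+1.
  rewrite [descent m (v, _)]descent_high //; apply: const => u i /andP[ji _].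
  apply: le_trans (descent_le _ _) _ => /=; apply: descent_ratio_mono.
  apply: leq_sub2r; rewrite leq_min leqnn andbT.
  by apply: leq_trans ji; rewrite -ltnS prednK ?height_gt0.
rewrite sum_nbr_seq.
have -> : \sum_(u in e v) descent m (u, j.+1) =
    descent_ratio ^+ (j.+1 - m) / gam * \sum_(u in e v) layer_leave (u, j.+1).
  rewrite mulr_sumr; apply: eq_bigr => u _; rewrite /descent /= jm jM /=.
  rewrite (minn_idPl _) ?mulrA; last by rewrite -ltnS prednK ?height_gt0.
  by rewrite mulrAC.
have -> : descent m (v, j.+1) =
    descent_ratio ^+ (j.+1 - m) / gam * layer_leave (v, j.+1).
  rewrite /descent /= jm jM /=.
  rewrite (minn_idPl _) ?mulrA; last by rewrite -ltnS prednK ?height_gt0.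
  by rewrite mulrAC.
have jM' : (j.+1 <= M.-1)%N by rewrite -ltnS prednK ?height_gt0.
have up : descent m (v, j.+2) <= descent_ratio ^+ (j.+1 - m).
  apply: le_trans (descent_le _ _) _; apply: descent_ratio_mono => /=.
  by apply: leq_sub2r; rewrite leq_min leqnSn.
have down : descent m (v, j) <= descent_ratio ^+ (j - m).
  apply: le_trans (descent_le _ _) _; apply: descent_ratio_mono => /=.
  by apply: leq_sub2r; rewrite leq_min leqnn /= (leq_trans (leqnSn j)).
have := layer_leave_super Ax.
have -> : descent_ratio ^+ (j.+1 - m) = descent_ratio * descent_ratio ^+ (j - m).
  by rewrite subSn ?exprS.
rewrite subSn // exprS in up.
set b := descent_ratio ^+ (j - m) in up down *.
have b0 : 0 < b by rewrite exprn_gt0 ?descent_ratio_gt0.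
have g2 : 0 < 2 - gam by have := gam_lt1; lra.
have -> : descent_ratio * b / gam = b / (2 - gam).
  by rewrite /descent_ratio; field; rewrite !gt_eqF ?gam_gt0.
set c := b / (2 - gam).
have c0 : 0 <= c by rewrite divr_ge0 ?ltW.
move=> /(ler_wpM2l c0); rewrite mulrDr => h.
have : descent_ratio * b + b = c * 2.
  by rewrite /descent_ratio /c; field; rewrite gt_eqF.
have -> : d.+2%:R * (c * layer_leave (v, j.+1)) =
    c * (d.+2%:R * layer_leave (v, j.+1)).
  by rewrite mulrCA.
lra.
Qed.

(** Half of the slack [1 - gam] available in the layer [M]: there the step up
    may gain the other half. *)
Definition surv_gap : R := (1 - gam) / 2.

(** A function that is strictly superharmonic off [A] and tends to infinity
    with the height: harmonic numbers are strictly concave and unbounded.  Its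
    existence plays the role of the recurrence of the vertical motion. *)
Definition survival (x : V * nat) : R :=
  if (x.2 < M)%N then layer_leave x
  else 1 + surv_gap * series harmonic (x.2 - M)%N.

Let gap0 : 0 < surv_gap.
Proof. by rewrite /surv_gap; have := gam_lt1; lra. Qed.

Lemma series_harmonic_ge0 n : 0 <= series (@harmonic R) n.
Proof. by apply: sumr_ge0 => i _; rewrite harmonic_ge0. Qed.

Lemma series_harmonic_mono i j : (i <= j)%N ->
  series (@harmonic R) i <= series (@harmonic R) j.
Proof.
move=> ij; apply: nondecreasing_series ij => n _ _; exact: harmonic_ge0.
Qed.

Lemma survival_ge0 x : 0 <= survival x.
Proof.
rewrite /survival; case: ifP => _; first exact: layer_leave_ge0.
apply: addr_ge0 => //; apply: mulr_ge0; first exact: ltW gap0.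
exact: series_harmonic_ge0.
Qed.

(** The gap is uniform on the layers up to [M + H] only: high up it comes from
    the second differences of the harmonic numbers, which tend to [0]. *)
Lemma survival_super H x : ~ A x -> (x.2 <= M + H)%N ->
  \sum_(y <- nbr_seq e x) survival y + surv_gap / (H.+1 * H.+2)%:R
  <= d.+2%:R * survival x.
Proof.
case: x => v [|j] Ax; first by have := notin_height Ax.
move=> /= jH; rewrite sum_nbr_seq.
have g1 := gam_lt1; have gg0 := gap0.
set sg := surv_gap / (H.+1 * H.+2)%:R.
have ss : sg <= surv_gap.
  by rewrite ler_pdivrMr ?ltr0n // ler_peMr ?(ltW gap0) // ler1n.
have gE : 2 * surv_gap = 1 - gam by rewrite /surv_gap; field.
have [jM|Mj] := ltnP j.+1 M.
  have -> : \sum_(u in e v) survival (u, j.+1) =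
      \sum_(u in e v) layer_leave (u, j.+1).
    by apply: eq_bigr => u _; rewrite /survival /= jM.
  have -> : survival (v, j.+1) = layer_leave (v, j.+1) by rewrite /survival /= jM.
  have := layer_leave_super Ax.
  have : survival (v, j) <= gam.
    rewrite /survival /= (ltn_trans _ jM) //; apply: layer_leave_le.
    exact: ltn_trans jM.
  have : survival (v, j.+2) <= 1.
    rewrite /survival /=; case: ltnP => h.
      by apply: le_trans (ltW g1); exact: layer_leave_le.
    have -> : (j.+2 - M = 0)%N by apply/eqP; rewrite subn_eq0.
    by rewrite /series /= big_geq // mulr0 addr0.
  by lra.
have E i u : (M <= i)%N -> survival (u, i) = 1 + surv_gap * series harmonic (i - M)%N.
  by rewrite /survival /= ltnNge => ->.
have -> : \sum_(u in e v) survival (u, j.+1) = survival (v, j.+1) * d%:R.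
  by rewrite -(sum_nbrs_const hd _ v); apply: eq_bigr => u _; rewrite !E.
rewrite -[X in _ <= X%:R * _](addn2 d) natrD (E j.+2) ?(leqW Mj) // (E j.+1) //.
have hS k : series (@harmonic R) k.+1 = series harmonic k + k.+1%:R^-1.
  by rewrite /series /= big_nat_recr.
have h0 : series (@harmonic R) 0 = 0 by rewrite /series /= big_geq.
move: Mj; rewrite leq_eqVlt => /predU1P[Mj|Mj].
  have -> : (j.+2 - M = 1)%N by rewrite Mj subSnn.
  have -> : (j.+1 - M = 0)%N by rewrite Mj subnn.
  have : survival (v, j) <= gam.
    by rewrite /survival /= Mj ltnSn; apply: layer_leave_le; rewrite Mj.
  rewrite hS h0 invr1 add0r mulr0 addr0 mulr1.
  lra.
have Mj' : (M <= j)%N by [].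
rewrite (E j) // !subSn // ?(leqW Mj') // !hS.
set i := (j - M)%N; set h := series harmonic i.
have iH : (i.+1 <= H)%N by rewrite /i -subSn // leq_subLR.
have : sg <= surv_gap * (i.+1%:R^-1 - i.+2%:R^-1).
  rewrite ler_pM2l //.
  have -> : i.+1%:R^-1 - i.+2%:R^-1 = (i.+1 * i.+2)%:R^-1 :> R.
    have i0 : i%:R + 1 != 0 :> R by rewrite natr1 gt_eqF ?ltr0n.
    have i1 : i%:R + 1 + 1 != 0 :> R by rewrite !natr1 gt_eqF ?ltr0n.
    by rewrite natrM -!natr1; field; rewrite i0 i1.
  rewrite lef_pV2 ?posrE ?ltr0n // ler_nat leq_mul // ltnS //.
    exact: leq_trans iH.
  exact: leq_trans iH _.
move: i.+1%:R^-1 i.+2%:R^-1 => a b.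
lra.
Qed.

(** Here [phi l x] bounds the probability that the walk from [x] avoids the
    boundary during [l] steps.  Let [K] be the value of [survival] at height
    [M + H].  Then [survival / K + (1 - q) ^ l], cut off at [1], will do: up to
    the layer [M + H] the gap of [survival] pays for the geometric decay, and
    higher up the cut-off is reached.  As [survival] is [1] on the layer [M],
    the bound there is [1 / K + (1 - q) ^ l], which is small for [H] large and
    then [l] large. *)
Lemma survival_vanish (eps : R) : 0 < eps ->
  exists phi : nat -> V * nat -> R,
    [/\ forall l x, 0 <= phi l x,
        forall x, phi 0%N x = 1,
        forall l x, ~ A x ->
          \sum_(y <- nbr_seq e x) phi l y <= d.+2%:R * phi l.+1 x
      & exists l, forall v, phi l (v, M) <= eps].
Proof.
move=> eps0.
have [H hH] : exists H, 2 / eps <= 1 + surv_gap * series harmonic H.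
  apply: contrapT => /forallNP nH; apply: (@dvg_harmonic R).
  apply: nondecreasing_is_cvgn; first exact: series_harmonic_mono.
  exists ((2 / eps - 1) / surv_gap) => _ [k _ <-].
  have /negP := nH k; rewrite -ltNge => hk.
  by rewrite ler_pdivlMr ?gap0 // mulrC; apply: ltW; lra.
set K := 1 + _ in hH.
have K1 : 1 <= K by rewrite /K lerDl mulr_ge0 ?series_harmonic_ge0 ?(ltW gap0).
have K0 : 0 < K by exact: lt_le_trans K1.
pose sg := surv_gap / (H.+1 * H.+2)%:R.
have sg0 : 0 < sg by rewrite divr_gt0 ?gap0 ?ltr0n.
have sg1 : sg <= 1.
  rewrite ler_pdivrMr ?ltr0n // mul1r (@le_trans _ _ 1) // ?ler1n //.
  by rewrite /surv_gap; have := gam_gt0; lra.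
pose q := sg / (K * d.+2%:R).
have q0 : 0 < q by rewrite divr_gt0 // mulr_gt0 // ltr0n.
have q1 : q <= 1.
  rewrite ler_pdivrMr ?mulr_gt0 ?ltr0n // mul1r (le_trans sg1) //.
  by rewrite (le_trans K1) // ler_peMr ?(ltW K0) // ler1n.
have th0 l : 0 <= (1 - q) ^+ l by rewrite exprn_ge0 ?subr_ge0.
exists (fun l x => Num.min 1 (survival x / K + (1 - q) ^+ l)); split.
- by move=> l x; rewrite le_min ler01 addr_ge0 ?divr_ge0 ?survival_ge0 ?(ltW K0).
- move=> x; apply/min_idPl; rewrite expr0 lerDr.
  by rewrite divr_ge0 ?survival_ge0 ?(ltW K0).
- move=> l [v [|j]] Ax; first by have := notin_height Ax.
  have sz := size_nbr_seq v j hd.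
  have S1 c : \sum_(y <- nbr_seq e (v, j.+1)) c = d.+2%:R * c :> R.
    by rewrite big_const_seq count_predT sz iter_addr_0 mulr_natl.
  have le1 : \sum_(y <- nbr_seq e (v, j.+1))
      Num.min 1 (survival y / K + (1 - q) ^+ l) <= d.+2%:R * 1.
    by rewrite -S1; apply: ler_sum => y _; rewrite ge_min lexx.
  have [jH|Hj] := leqP j.+1 (M + H); last first.
    rewrite (min_idPl _) // ler_wpDr // ler_pdivlMr // mul1r.
    rewrite /survival /= ltnNge (leq_trans (leq_addr H M)) ?(ltnW Hj) //=.
    rewrite lerD2l ler_wpM2l ?(ltW gap0) //; apply: series_harmonic_mono.
    by rewrite leq_subRL ?(leq_trans (leq_addr H M)) ?(ltnW Hj).
  rewrite minr_pMr ?ler0n // le_min le1 /=.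
  apply: (@le_trans _ _ (\sum_(y <- nbr_seq e (v, j.+1))
      (survival y / K + (1 - q) ^+ l))).
    by apply: ler_sum => y _; rewrite ge_min lexx orbT.
  rewrite big_split /= S1 -mulr_suml exprS mulrDr mulrA.
  have := survival_super Ax jH; rewrite -/sg => h.
  have {}h : (\sum_(y <- nbr_seq e (v, j.+1)) survival y + sg) / K <=
      d.+2%:R * survival (v, j.+1) / K by rewrite ler_pM2r ?invr_gt0.
  rewrite mulrDl in h; apply: le_trans (lerD h (lexx _)) => {h}.
  have : d.+2%:R * (q * (1 - q) ^+ l) <= sg / K.
    rewrite mulrA /q.
    have -> : d.+2%:R * (sg / (K * d.+2%:R)) = sg / K.
      by field; rewrite !gt_eqF ?ltr0n // -natrD.
    by rewrite ler_piMr ?divr_ge0 ?(ltW sg0) ?(ltW K0) ?exprn_ile1 ?subr_ge0 //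
      gerBl ltW.
  lra.
have : (1 - q) ^+ l @[l --> \oo] --> 0.
  by apply: cvg_expr; rewrite ger0_norm ?subr_ge0 // gtrBl.
move=> /cvgrPdist_lt /(_ (eps / 2)); rewrite divr_gt0 // => /(_ isT).
case=> l _ /(_ l (leqnn _)) /=; rewrite sub0r normrN ger0_norm // => hl.
exists l => v; rewrite ge_min; apply/orP; right.
have -> : survival (v, M) = 1.
  by rewrite /survival /= ltnn subnn /series /= big_geq // mulr0 addr0.
have : 1 / K <= eps / 2.
  by rewrite ler_pdivrMr // -ler_pdivrMl ?divr_gt0 // mulr1 invf_div.
lra.
Qed.

End Superharmonic.

(** * The height of an aggregate *)
Section Height.
Context (V : finType) (e : rel V).
Implicit Types (A : set (V * nat)).

Lemma has_height_uniq A M N : has_height A M -> has_height A N -> M = N.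
Proof.
move=> [M1 M2] [N1 N2]; apply/eqP; rewrite eqn_leq; apply/andP; split.
  by rewrite leqNgt; apply/negP => /M1[v /N2]; rewrite ltnn.
by rewrite leqNgt; apply/negP => /N1[v /M2]; rewrite ltnn.
Qed.

Lemma layer_meets A M m : has_height A M ->
  (A `&` layer V m !=set0) <-> (m < M)%N.
Proof.
move=> [M1 M2]; split; first by move=> [x [/M2 + <-]].
by move=> /M1[v Av]; exists (v, m).
Qed.

Lemma first_empty_layerE A M : has_height A M -> first_empty_layer A = [set M].
Proof.
move=> AM; have h j : (layer V j `&` A = set0) <-> (M <= j)%N.
  rewrite setIC leqNgt; split => [A0|/negP jM].
    by apply/negP => /(layer_meets _ AM); rewrite A0 => -[].
  by apply/seteqP; split=> // x Ax; apply: jM; apply/(layer_meets _ AM); exists x.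
apply/seteqP; split=> k /=; rewrite /first_empty_layer /least /=.
  move=> [/h Mk /(_ M)]; rewrite h leqnn => /(_ isT) kM.
  by apply/eqP; rewrite eqn_leq kM.
by move=> ->; split; [exact/h | move=> j /h].
Qed.

Lemma has_height_add A M y : has_height A M -> boundary e A y ->
  has_height (A `|` [set y]) (if (y.2 == M)%N then M.+1 else M).
Proof.
move=> [M1 M2] [Ay [z Az yz]].
have yM : (y.2 <= M)%N.
  have := M2 _ Az; case/orP: yz => [/andP[/eqP -> _]|/andP[_ /orP[]/eqP h]].
  - exact: ltnW.
  - by rewrite h => /ltnW/ltnW.
  - by rewrite h.
case: eqP => [yE|/eqP yE]; split.
- move=> j; rewrite ltnS leq_eqVlt => /predU1P[->|/M1[v Av]].
    by exists y.1; right; rewrite /= -yE -surjective_pairing.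
  by exists v; left.
- by move=> x [/M2/ltnW|->] //=; rewrite ltnS.
- by move=> j /M1[v Av]; exists v; left.
- by move=> x [/M2|->] //=; rewrite ltn_neqAle yE.
Qed.

Lemma has_height_finite A M : has_height A M -> finite_set A.
Proof.
move=> [_ AM].
have : finite_set (\bigcup_(i in `I_M) layer V i).
  by apply: bigcup_finite => // i _; exact: finite_layer.
by apply: sub_finite_set => x /AM xM; exists x.2.
Qed.

End Height.

Section Least.
Variable S : set nat.

Lemma least_ex : S !=set0 -> exists k, least S k.
Proof.
case=> k Sk; have ex : exists k, `[< S k >] by exists k; apply/asboolP.
exists (ex_minn ex); case: ex_minnP => m /asboolP Sm hm; split=> // j Sj.
by apply: hm; apply/asboolP.
Qed.

Lemma least_uniq j k : least S j -> least S k -> j = k.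
Proof.
by move=> [Sj hj] [Sk hk]; apply/eqP; rewrite eqn_leq hj // hk.
Qed.

End Least.

(** * Outcomes of stopped paths *)
Section Outcome.
Context (X : Type) (C T : set X) (b : Prop).

(** The path [y] is observed from time [k] for [l] steps and stopped at its
    first visit to [C].  The outcome is whether that visit is in [T]; if there
    is no visit, it is [b].  So [T] with [False] describes landing in [T], and
    the empty set with [True] describes surviving.  The recursion on the
    remaining time is the one used with the Markov property. *)
Fixpoint outcome (l k : nat) (y : nat -> X) : Prop :=
  (C (y k) /\ T (y k)) \/
  (~ C (y k) /\ (if l is l'.+1 then outcome l' k.+1 y else b)).

Lemma outcome_first l k y r : C (y (k + r)%N) ->
  (forall i, (i < r)%N -> ~ C (y (k + i)%N)) -> (r <= l)%N -> T (y (k + r)%N) ->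
  outcome l k y.
Proof.
elim: l k r => [|l IH] k [|r] //=; rewrite ?addn0; try by left.
rewrite addnS -addSn => Cr hr rl Tr; right; split.
  by have := hr 0%N; rewrite addn0; apply.
apply: (IH k.+1 r) => // i ir; rewrite addSn -addnS; exact: hr.
Qed.

Lemma outcome_never l k y : (forall i, ~ C (y i)) -> b -> outcome l k y.
Proof. by move=> nC hb; elim: l k => [|l IH] k /=; right. Qed.

End Outcome.

(** * Measurability of events of the process *)
Section MeasurableProp.
Context (d : measure_display) (Omega : measurableType d).
Implicit Types (Q : Omega -> Prop).

(** With this form, measurability is proved along the logical structure of the
    proposition that describes the event. *)
Definition mprop Q := measurable [set w | Q w].

Lemma mprop_ext Q Q' : (forall w, Q w <-> Q' w) -> mprop Q -> mprop Q'.
Proof.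
move=> QQ'; rewrite /mprop.
by suff -> : [set w | Q w] = [set w | Q' w] by []; apply/seteqP; split=> w /QQ'.
Qed.

Lemma mprop_const (p : Prop) : mprop (fun=> p).
Proof.
have [hp|hp] := pselect p.
  by apply: (@mprop_ext (fun=> True)) => //; exact: measurableT.
by apply: (@mprop_ext (fun=> False)) => //; exact: measurable0.
Qed.

Lemma mprop_not Q : mprop Q -> mprop (fun w => ~ Q w).
Proof. exact: measurableC. Qed.

Lemma mprop_and Q Q' : mprop Q -> mprop Q' -> mprop (fun w => Q w /\ Q' w).
Proof. exact: measurableI. Qed.

Lemma mprop_or Q Q' : mprop Q -> mprop Q' -> mprop (fun w => Q w \/ Q' w).
Proof. exact: measurableU. Qed.

Lemma mprop_imp Q Q' : mprop Q -> mprop Q' -> mprop (fun w => Q w -> Q' w).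
Proof.
move=> /mprop_not mQ mQ'; apply: mprop_ext (mprop_or mQ mQ') => w.
by split=> [[]//|h]; have [/h|] := pselect (Q w); [right|left].
Qed.

Lemma mprop_iff Q Q' : mprop Q -> mprop Q' -> mprop (fun w => Q w <-> Q' w).
Proof. by move=> mQ mQ'; apply: mprop_and; apply: mprop_imp. Qed.

Lemma mprop_ex (I : countType) (Q : I -> Omega -> Prop) :
  (forall i, mprop (Q i)) -> mprop (fun w => exists i, Q i w).
Proof.
move=> mQ; apply: (@mprop_ext (fun w => (\bigcup_i [set w | Q i w]) w)).
  by move=> w; split=> [[i _ h]|[i h]]; exists i.
by apply: countable_bigcupT_measurable => //; exact: countableP.
Qed.

Lemma mprop_all (I : countType) (Q : I -> Omega -> Prop) :
  (forall i, mprop (Q i)) -> mprop (fun w => forall i, Q i w).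
Proof.
move=> mQ; apply: (@mprop_ext (fun w => ~ exists i, ~ Q i w)).
  by move=> w; rewrite -forallNE; split=> h i; [exact: contrapT | exact].
by apply/mprop_not/mprop_ex => i; exact: mprop_not.
Qed.

End MeasurableProp.

Section DLA.
Context (V : finType) (e : rel V) (d : nat).
Hypotheses (hG : simple_connected_graph e) (hd : regular_graph e d).
Context (disp : measure_display) (Omega : measurableType disp) (R : realType).
Context (P : probability Omega R).
Context (A : nat -> Omega -> set (V * nat)) (W : nat -> nat -> Omega -> V * nat).
Hypothesis hA : cylinder_DLA P e A W.

Definition first_hit t w k : Prop :=
  least [set r | boundary e (A t w) (W t.+1 r w)] k.

Lemma aggregate_step t w :
  (A t.+1 w = A t w /\ forall k, ~ boundary e (A t w) (W t.+1 k w)) \/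
  (exists2 k, first_hit t w k & A t.+1 w = A t w `|` [set W t.+1 k w]).
Proof.
rewrite (dla_step hA); set S := least _.
have [[k hk]|nS] := pselect ([set r | boundary e (A t w) (W t.+1 r w)] !=set0).
  have [k' lk'] : exists k, S k by apply: least_ex; exists k.
  right; exists k' => //; congr (_ `|` _); apply/seteqP; split=> x /=.
    by move=> [j /(least_uniq lk') <- <-].
  by move=> ->; exists k'.
left; split; last by move=> k bk; apply: nS; exists k.
apply/seteqP; split=> x; last by left.
by case=> // -[k [bk _] _]; exfalso; apply: nS; exists k.
Qed.

Lemma aggregate_nondec s t w : (s <= t)%N -> A s w `<=` A t w.
Proof.
elim: t => [|t IH]; first by rewrite leqn0 => /eqP ->.
rewrite leq_eqVlt ltnS => /predU1P[->//|/IH h]; apply: subset_trans h _.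
by rewrite (dla_step hA) => x; left.
Qed.

Lemma aggregate_layer0 t w : layer V 0 `<=` A t w.
Proof. by rewrite -(dla_start hA w); exact: aggregate_nondec. Qed.

(** The walk has values in [V * nat], and a probability space has a point. *)
Lemma card_vertices_gt0 : (0 < #|V|)%N.
Proof.
suff : exists w : Omega, True.
  by case=> w _; apply/card_gt0P; exists (W 1 0 w).1.
apply: contrapT => nw; have := probability_setT P.
suff -> : [set: Omega] = set0.
  by rewrite measure0 => /eqP; rewrite lt_eqF // lte01.
by apply/seteqP; split=> // w _; apply: nw; exists w.
Qed.

Lemma has_height_start w : has_height (A 0%N w) 1.
Proof.
rewrite (dla_start hA); split; last by move=> x /= ->.
by case=> // _; have /card_gt0P[v _] := card_vertices_gt0; exists v.
Qed.

Lemma has_height_ex t w : exists M, has_height (A t w) M.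
Proof.
elim: t => [|t [M hM]].
  by exists 1%N; exact: has_height_start.
have [[-> _]|[k [bk _] ->]] := aggregate_step t w; first by exists M.
by exists (if (W t.+1 k w).2 == M then M.+1 else M)%N; apply: (has_height_add hM bk).
Qed.

(** The default [0] is never used, by [heightP]. *)
Definition height t w : nat := xget 0%N [set M | has_height (A t w) M].

Lemma heightP t w : has_height (A t w) (height t w).
Proof. by apply: xgetPex; exact: has_height_ex. Qed.

Lemma height_eq t w M : has_height (A t w) M -> height t w = M.
Proof. exact: has_height_uniq (heightP t w). Qed.

Lemma height_nondec t w : (height t w <= height t.+1 w)%N.
Proof.
rewrite leqNgt; apply/negP => h.
have : A t w `&` layer V (height t.+1 w) !=set0.
  exact/(layer_meets _ (heightP t w)).
case=> x [Ax xl]; have : A t.+1 w `&` layer V (height t.+1 w) !=set0.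
  by exists x; split=> //; exact: (aggregate_nondec (leqnSn t)).
by move/(layer_meets _ (heightP t.+1 w)); rewrite ltnn.
Qed.

Lemma aggregate_finite t w : finite_set (A t w).
Proof. exact: has_height_finite (heightP t w). Qed.

Lemma mprop_walk_eq t k x : mprop (fun w => W t.+1 k w = x).
Proof. exact: dla_measurable hA t k x. Qed.

Lemma mprop_walk t k (Q : V * nat -> Omega -> Prop) :
  (forall x, mprop (Q x)) -> mprop (fun w => Q (W t.+1 k w) w).
Proof.
move=> mQ; apply: (@mprop_ext _ _ (fun w => exists x, W t.+1 k w = x /\ Q x w)).
  by move=> w; split=> [[x [-> ]]//|h]; exists (W t.+1 k w).
by apply: mprop_ex => x; apply: mprop_and => //; exact: mprop_walk_eq.
Qed.

(* A finite set of vertices is one of countably many. *)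
Let mprop_aggregate_of t (Q : set (V * nat) -> Prop) :
  (forall x, mprop (fun w => A t w x)) -> mprop (fun w => Q (A t w)).
Proof.
move=> mA; apply: (@mprop_ext _ _ (fun w => exists F : {fset V * nat},
    Q [set` F] /\ forall x, A t w x <-> [set` F] x)).
  move=> w; split=> [[F [QF AF]]|QA].
    by suff -> : A t w = [set` F] by []; apply/seteqP; split=> x /AF.
  exists (fset_set (A t w)); rewrite fset_setK //; exact: aggregate_finite.
apply: mprop_ex => F; apply: mprop_and; first exact: mprop_const.
by apply: mprop_all => x; apply: mprop_iff => //; exact: mprop_const.
Qed.

Lemma mprop_aggregate t (Q : set (V * nat) -> Prop) : mprop (fun w => Q (A t w)).
Proof.
apply: mprop_aggregate_of; elim: t => [|t IH] x.
  apply: mprop_ext (mprop_const _ (layer V 0 x)) => w.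
  by rewrite (dla_start hA).
have mb k : mprop (fun w => boundary e (A t w) (W t.+1 k w)).
  apply: (@mprop_walk t k (fun x w => boundary e (A t w) x)) => y.
  exact: (mprop_aggregate_of (fun S => boundary e S y)).
apply: (@mprop_ext _ _ (fun w => A t w x \/ exists k, first_hit t w k /\
    W t.+1 k w = x)).
  move=> w; rewrite (dla_step hA); split=> -[Ax|]; try by left.
    by move=> [k [hk kx]]; right; exists k.
  by move=> [k hk kx]; right; exists k.
have mh k : mprop (fun w => first_hit t w k).
  apply: mprop_and; first exact: mb.
  by apply: mprop_all => j; apply: mprop_imp; [exact: mb|exact: mprop_const].
apply: mprop_or => //; apply: mprop_ex => k; apply: mprop_and; first exact: mh.
exact: mprop_walk_eq.
Qed.

Lemma mprop_outcome t C T b l k :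
  mprop (fun w => outcome C T b l k (W t.+1 ^~ w)).
Proof.
elim: l k => [|l IH] k /=; (apply: mprop_or; [|apply: mprop_and => //]).
- apply: (@mprop_walk t k (fun x _ => C x /\ T x)) => x; exact: mprop_const.
- apply: (@mprop_walk t k (fun x _ => ~ C x)) => x; exact: mprop_const.
- exact: mprop_const.
- apply: (@mprop_walk t k (fun x _ => C x /\ T x)) => x; exact: mprop_const.
- apply: (@mprop_walk t k (fun x _ => ~ C x)) => x; exact: mprop_const.
Qed.

End DLA.


(** * Probabilities as real numbers *)
Section RealProbability.
Context (disp : measure_display) (Omega : measurableType disp) (R : realType).
Context (P : probability Omega R).

Definition pr (S : set Omega) : R := fine (P S).

Lemma prE S : measurable S -> P S = (pr S)%:E.
Proof. by move=> mS; rewrite /pr fineK // fin_num_measure. Qed.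

Lemma pr_ge0 S : 0 <= pr S.
Proof. by rewrite fine_ge0. Qed.

Lemma pr0 : pr set0 = 0.
Proof. by rewrite /pr measure0. Qed.

Lemma le_pr S S' : measurable S -> measurable S' -> S `<=` S' -> pr S <= pr S'.
Proof.
by move=> mS mS' SS'; rewrite -lee_fin -!prE // le_measure ?inE.
Qed.

Lemma pr_le1 S : measurable S -> pr S <= 1.
Proof. by move=> mS; rewrite -lee_fin -prE // probability_le1. Qed.

Lemma pr_split S B : measurable S -> measurable B ->
  pr S = pr (S `&` B) + pr (S `&` ~` B).
Proof.
move=> mS mB; have mI := measurableI _ _ mS mB.
have mD := measurableI _ _ mS (measurableC mB).
apply: EFin_inj; rewrite EFinD -!prE // -measureU //.
  by rewrite -setIUr setUv setIT.
by rewrite setIACA setICr setI0.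
Qed.

Section Exhaust.
Context (T : countType) (X : Omega -> T).
Hypothesis mX : forall y, measurable [set w | X w = y].

Let mXs (s : seq T) : measurable [set w | X w \in s].
Proof.
apply: (@mprop_ext _ _ (fun w => exists y, (y \in s) /\ X w = y)).
  by move=> w; split=> [[y [ys ->]]//|h]; exists (X w).
by apply: mprop_ex => y; apply: mprop_and; [exact: mprop_const|exact: mX].
Qed.

Lemma pr_seq F (s : seq T) : measurable F -> uniq s ->
  pr (F `&` [set w | X w \in s]) = \sum_(y <- s) pr (F `&` [set w | X w = y]).
Proof.
move=> mF; elim: s => [|y s IH] /=.
  rewrite big_nil => _; suff -> : F `&` [set w | X w \in [::]] = set0 by rewrite pr0.
  by apply/seteqP; split=> // w [].
move=> /andP[ys us]; rewrite big_cons -IH //.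
rewrite (pr_split (measurableI _ _ mF (mXs (y :: s))) (mX y)); congr (_ + _); congr pr.
  apply/seteqP; split=> w; first by move=> [[]].
  by move=> [Fw Xy]; split=> //; split=> //=; rewrite Xy mem_head.
apply/seteqP; split=> w /=.
  by move=> [[Fw]]; rewrite in_cons => /predU1P[].
move=> [Fw Xs]; split; first by split; rewrite // in_cons Xs orbT.
by move=> XE; move: ys; rewrite -XE Xs.
Qed.

(** When the values in [s] exhaust the mass of [F], the rest of [F] is null.
    This is how the walk is confined to neighbours although only
    probabilities, and no pointwise property of the walk, are given. *)
Lemma pr_exhaust F B (s : seq T) : measurable F -> measurable B -> uniq s ->
  pr F <= \sum_(y <- s) pr (F `&` [set w | X w = y]) ->
  pr (F `&` B) <= \sum_(y <- s) pr (F `&` [set w | X w = y] `&` B).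
Proof.
move=> mF mB us; rewrite -pr_seq // (pr_split mF (mXs s)) gerDl => h.
rewrite (pr_split (measurableI _ _ mF mB) (mXs s)) pr_seq //; last exact: measurableI.
rewrite -[leRHS]addr0 lerD //.
  by apply: ler_sum => y _; rewrite setIAC.
apply: le_trans h; apply: le_pr; [| |by move=> w [[]]].
  by apply: measurableI; [exact: measurableI|exact/measurableC/mXs].
by apply: measurableI => //; exact/measurableC/mXs.
Qed.

End Exhaust.

End RealProbability.

(** * One particle, given the history of the aggregate *)
Section OneStep.
Context (V : finType) (e : rel V) (d : nat).
Hypotheses (hG : simple_connected_graph e) (hd : regular_graph e d).
Context (disp : measure_display) (Omega : measurableType disp) (R : realType).
Context (P : probability Omega R).
Context (A : nat -> Omega -> set (V * nat)) (W : nat -> nat -> Omega -> V * nat).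
Hypothesis hA : cylinder_DLA P e A W.
Context (t : nat) (w0 : Omega).

Local Notation pr := (pr P).
Local Notation height := (height A).

(** Histories of the aggregate are represented by the points [w0] at which they
    occur, so the invariants of the aggregate hold for them. *)
Definition history : set Omega :=
  [set w | forall s, (s <= t)%N -> A s w = A s w0].

Lemma measurable_history : measurable history.
Proof.
apply: mprop_all => s; apply: mprop_imp; first exact: mprop_const.
exact: (mprop_aggregate hA s (fun S => S = A s w0)).
Qed.

Definition follows (k : nat) (x : nat -> V * nat) : set Omega :=
  [set w | forall r, (r <= k)%N -> W t.+1 r w = x r].

Lemma measurable_follows k x : measurable (follows k x).
Proof.
apply: mprop_all => r; apply: mprop_imp; first exact: mprop_const.
exact: mprop_walk_eq hA t r (x r).
Qed.

Let a := A t w0.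
Let M := height t w0.
Let aM : has_height a M := heightP hA t w0.

Let mH := measurable_history.
Let mHF k x := measurableI _ _ mH (measurable_follows k x).

Lemma pr_follows k x :
  pr (history `&` follows k x) = pr history * walk_prob R e a x k.
Proof.
have := dla_walk hA t k (fun s => A s w0) x.
by rewrite !prE //; [move=> [] | exact: mHF].
Qed.

Definition extend (x : nat -> V * nat) k y r := if (r <= k)%N then x r else y.

Lemma follows_extend k x y :
  follows k x `&` [set w | W t.+1 k.+1 w = y] = follows k.+1 (extend x k y).
Proof.
apply/seteqP; split=> w; rewrite /follows /extend /=.
  move=> [h hy] r; rewrite leq_eqVlt ltnS => /predU1P[->|rk].
    by rewrite ltnn.
  by rewrite rk; exact: h.
move=> h; split; last by rewrite h // ltnn.
by move=> r rk; rewrite h ?rk // (leq_trans rk).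
Qed.

Lemma walk_prob_extend k x y :
  walk_prob R e a (extend x k y) k.+1 = walk_prob R e a x k * step_prob R e (x k) y.
Proof.
rewrite /walk_prob big_ord_recr /= mulrA {1}/extend leq0n.
congr (_ * _ * _); last by rewrite /extend leqnn ltnn.
by apply: eq_bigr => i _; rewrite /extend (ltnW (ltn_ord i)) ltn_ord.
Qed.

Lemma follows0 y : follows 0 (fun=> y) = [set w | W t.+1 0%N w = y].
Proof.
apply/seteqP; split=> w; rewrite /follows /=; first by apply.
by move=> h r; rewrite leqn0 => /eqP ->.
Qed.

Lemma pr_start v : pr (history `&` [set w | W t.+1 0%N w = (v, M)]) =
  pr history * #|V|%:R^-1.
Proof.
rewrite -follows0 pr_follows /walk_prob big_ord0 mulr1 (first_empty_layerE aM).
by rewrite mem_set // mul1r.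
Qed.

Lemma notin_agg_pos x : ~ a x -> (0 < x.2)%N.
Proof. exact: (notin_height (@aggregate_layer0 _ _ _ _ _ _ _ _ hA t w0)). Qed.

(** Off the aggregate a vertex is not in layer [0], hence has exactly [d + 2]
    neighbours. *)
Lemma sum_pr_extend k x : ~ a (x k) ->
  \sum_(y <- nbr_seq e (x k)) pr (history `&` follows k.+1 (extend x k y)) =
  pr (history `&` follows k x).
Proof.
move=> axk; have xk0 := notin_agg_pos axk.
rewrite (eq_big_seq (fun=> pr (history `&` follows k x) * d.+2%:R^-1)); last first.
  move=> y yx; rewrite !pr_follows walk_prob_extend (step_prob_nbr R hd) //.
  by rewrite mulrA.
rewrite big_const_seq count_predT.
have -> : size (nbr_seq e (x k)) = d.+2.
  by move: xk0; case: (x k) => v [|j] // _; exact: size_nbr_seq.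
by rewrite iter_addr_0 -[LHS]mulr_natr -mulrA mulVf ?mulr1 // pnatr_eq0.
Qed.

(** The conditions make [phi l] a supersolution, off the aggregate, of the
    backward equation for the probability of the outcome after [l] steps. *)
Section Comparison.
Context (T : set (V * nat)) (b : Prop) (phi : nat -> V * nat -> R).
Hypotheses (phi0 : forall l x, 0 <= phi l x)
  (phiT : forall l x, boundary e a x -> T x -> 1 <= phi l x)
  (phib : b -> forall x, 1 <= phi 0%N x)
  (phiS : forall l x, ~ a x ->
     \sum_(y <- nbr_seq e x) phi l y <= d.+2%:R * phi l.+1 x).

Local Notation out l k :=
  [set w | outcome (boundary e a) T b l k (W t.+1 ^~ w)].

Let mout l k : measurable (out l k).
Proof. exact: (mprop_outcome hA t (boundary e a) T b l k). Qed.

(** Optional stopping, by induction on the remaining time [l].  As long as the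
    boundary is avoided, the next position is off the aggregate too, so the
    supersolution inequality is available at each step. *)
Lemma outcome_follows_le l k x : ~ a (x k) ->
  pr (history `&` follows k x `&` out l k) <=
  pr (history `&` follows k x) * phi l (x k).
Proof.
have triv l' k' x' : 1 <= phi l' (x' k') ->
    pr (history `&` follows k' x' `&` out l' k') <=
    pr (history `&` follows k' x') * phi l' (x' k').
  move=> c1; apply: (@le_trans _ _ (pr (history `&` follows k' x'))).
    by apply: le_pr; [exact: measurableI| |move=> w []].
  by rewrite ler_peMr ?pr_ge0.
have none l' k' x' : (forall w, follows k' x' w -> ~ out l' k' w) ->
    pr (history `&` follows k' x' `&` out l' k') <=
    pr (history `&` follows k' x') * phi l' (x' k').
  move=> hS; suff -> : history `&` follows k' x' `&` out l' k' = set0.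
    by rewrite pr0 mulr_ge0 ?pr_ge0.
  by apply/seteqP; split=> // w [[_ /hS]].
have at_k k' x' w : follows k' x' w -> W t.+1 k' w = x' k' by apply.
have stopped l' k' x' : boundary e a (x' k') ->
    pr (history `&` follows k' x' `&` out l' k') <=
    pr (history `&` follows k' x') * phi l' (x' k').
  move=> bx; have [Tx|Tx] := pselect (T (x' k')); first exact/triv/phiT.
  apply: none => w /at_k wx; case: l' => [|l'] /=; rewrite wx.
    by case=> -[].
  by case=> -[].
elim: l k x => [|l IH] k x axk.
  have [/stopped//|nbx] := pselect (boundary e a (x k)).
  have [hb|nb] := pselect b; first exact/triv/phib.
  by apply: none => w /at_k wx /=; rewrite wx; case=> -[].
have [/stopped//|nbx] := pselect (boundary e a (x k)).
have nbr_out y : y \in nbr_seq e (x k) -> ~ a y.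
  rewrite mem_nbr_seq => xy ay; apply: nbx; split=> //; by exists y.
have -> : history `&` follows k x `&` out l.+1 k =
    history `&` follows k x `&` out l k.+1.
  apply/seteqP; split=> w [[Hw fw] ow]; split=> //.
    by case: ow => -[]; rewrite ?(at_k _ _ _ fw).
  by right; rewrite (at_k _ _ _ fw).
have mX y : measurable [set w | W t.+1 k.+1 w = y] by exact: mprop_walk_eq hA t k.+1 y.
apply: (le_trans (pr_exhaust (X := W t.+1 k.+1) mX (mHF k x) (mout l k.+1)
  (nbr_seq_uniq e (x k)) _)).
  rewrite -sum_pr_extend //; apply: ler_sum => y _.
  by rewrite -setIA follows_extend.
apply: (@le_trans _ _ (\sum_(y <- nbr_seq e (x k))
    pr (history `&` follows k x) * d.+2%:R^-1 * phi l y)).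
  rewrite !big_seq; apply: ler_sum => y yx.
  rewrite -(setIA history) follows_extend.
  apply: le_trans (IH k.+1 (extend x k y) _) _.
    by rewrite /extend ltnn; exact: nbr_out.
  rewrite !pr_follows walk_prob_extend (step_prob_nbr R hd) ?notin_agg_pos //.
  by rewrite mulrA /extend ltnn.
rewrite -mulr_sumr -mulrA ler_wpM2l ?pr_ge0 // mulrC ler_pdivrMr ?ltr0n //.
by rewrite mulrC; exact: phiS.
Qed.

(** Averaging over the starting point, which is uniform on the first empty
    layer. *)
Lemma outcome_history_le l c : (forall v, phi l (v, M) <= c) ->
  pr (history `&` out l 0) <= pr history * c.
Proof.
move=> hc; have n0 := card_vertices_gt0 P W.
have mX y : measurable [set w | W t.+1 0%N w = y] by exact: mprop_walk_eq hA t 0%N y.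
pose s := [seq (v, M) | v <- enum V].
have us : uniq s by rewrite map_inj_uniq ?enum_uniq // => ? ? [].
have sumV (r : R) : \sum_(y <- s) r = #|V|%:R * r.
  by rewrite big_const_seq count_predT size_map -cardE iter_addr_0 mulr_natl.
have aMv v : ~ a (v, M) by move=> /(aM.2); rewrite ltnn.
apply: (le_trans (pr_exhaust (X := W t.+1 0%N) mX mH (mout l 0) us _)).
  rewrite (eq_big_seq (fun=> pr history * #|V|%:R^-1)); last first.
    by move=> _ /mapP[v _ ->]; rewrite pr_start.
  by rewrite sumV mulrCA mulfV ?mulr1 // pnatr_eq0 -lt0n.
apply: (@le_trans _ _ (\sum_(y <- s) pr history * #|V|%:R^-1 * c)).
  rewrite !big_seq; apply: ler_sum => _ /mapP[v _ ->]; rewrite -follows0.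
  apply: le_trans (outcome_follows_le l _) _ => //; rewrite follows0 pr_start.
  by rewrite ler_wpM2l // mulr_ge0 ?pr_ge0 // invr_ge0 ler0n.
by rewrite sumV mulrA mulrCA mulfV ?mulr1 // pnatr_eq0 -lt0n.
Qed.

End Comparison.
End OneStep.


(** * Averaging over histories *)
Section HistorySums.
Context (V : finType) (e : rel V) (d : nat).
Hypotheses (hG : simple_connected_graph e) (hd : regular_graph e d).
Context (disp : measure_display) (Omega : measurableType disp) (R : realType).
Context (P : probability Omega R).
Context (A : nat -> Omega -> set (V * nat)) (W : nat -> nat -> Omega -> V * nat).
Hypothesis hA : cylinder_DLA P e A W.

Local Notation pr := (pr P).
Local Notation height := (height A).
Local Notation mH := (measurable_history hA).

Lemma pr_le_bigcup (F : nat -> set Omega) c : (forall l, measurable (F l)) ->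
  {homo F : i j / (i <= j)%N >-> (i <= j)%O} ->
  (forall l, pr (F l) <= c) -> pr (\bigcup_l F l) <= c.
Proof.
move=> mF homoF hc.
have mU : measurable (\bigcup_l F l) by exact: bigcupT_measurable.
have cv := nondecreasing_cvg_mu (mu := P) mF mU homoF.
rewrite -lee_fin -prE // -(cvg_lim _ cv) //.
apply: lime_le; first by apply/cvg_ex; eexists; exact: cv.
by apply: nearW => l /=; rewrite prE // lee_fin.
Qed.

Definition lands_low (t m : nat) : set Omega :=
  [set w | exists k, first_hit e A W t w k /\ ((W t.+1 k w).2 <= m)%N].

Definition never_hits (t : nat) : set Omega :=
  [set w | forall k, ~ boundary e (A t w) (W t.+1 k w)].

Lemma mprop_boundary t k : mprop (fun w => boundary e (A t w) (W t.+1 k w)).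
Proof.
apply: (mprop_walk hA t k (Q := fun x w => boundary e (A t w) x)) => x.
exact: (mprop_aggregate hA t (fun S => boundary e S x)).
Qed.

Lemma mprop_first_hit t k : mprop (fun w => first_hit e A W t w k).
Proof.
apply: mprop_and; first exact: mprop_boundary.
apply: mprop_all => j.
by apply: mprop_imp; [exact: mprop_boundary|exact: mprop_const].
Qed.

Lemma mprop_lands t k m :
  mprop (fun w => first_hit e A W t w k /\ ((W t.+1 k w).2 <= m)%N).
Proof.
apply: mprop_and; first exact: mprop_first_hit.
apply: (mprop_walk hA t k (Q := fun x w => (x.2 <= m)%N)) => x; exact: mprop_const.
Qed.

Lemma measurable_lands_low t m : measurable (lands_low t m).
Proof. by apply: mprop_ex => k; exact: mprop_lands. Qed.

Lemma measurable_never_hits t : measurable (never_hits t).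
Proof. by apply: mprop_all => k; apply: mprop_not; exact: mprop_boundary. Qed.

Lemma mprop_height t (Q : nat -> Prop) : mprop (fun w => Q (height t w)).
Proof.
apply: mprop_ext (mprop_aggregate hA t
  (fun S => Q (xget 0%N [set M | has_height S M]))) => w.
by [].
Qed.

Let V0 := card_vertices_gt0 P W.

(** The comparison with [descent], which is at least [1] on the low layers and
    constant on the starting layer. *)
Lemma history_lands_low t m w0 : (m < height t w0)%N ->
  pr (history A t w0 `&` lands_low t m) <=
  pr (history A t w0) * descent_ratio R V d ^+ ((height t w0).-1 - m).
Proof.
move=> mM; have aM := heightP hA t w0; have a0 := aggregate_layer0 hA t w0.
set M := height t w0 in mM aM *; set a := A t w0 in aM a0 *.
(* Finitely many steps first: the outcome bound is uniform in [l]. *)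
pose F l := [set w | exists k, (first_hit e A W t w k /\
  ((W t.+1 k w).2 <= m)%N) /\ (k <= l)%N].
have mF l : measurable (history A t w0 `&` F l).
  apply: measurableI; first exact: mH.
  apply: mprop_ex => k; apply: mprop_and; [exact: mprop_lands|exact: mprop_const].
have -> : history A t w0 `&` lands_low t m = \bigcup_l (history A t w0 `&` F l).
  apply/seteqP; split=> w.
    by move=> [Hw [k hk]]; exists k => //; split=> //; exists k.
  by move=> [l _ [Hw [k [hk _]]]]; split=> //; exists k.
apply: pr_le_bigcup => //.
  move=> i j ij; apply/subsetPset => w [Hw [k [hk ki]]]; split=> //.
  by exists k; split=> //; exact: leq_trans ij.
move=> l.
apply: le_trans (outcome_history_le hd hA (T := [set x | (x.2 <= m)%N])
  (b := False) (phi := fun _ => descent R e d a M m) _ _ _ _ (l := l) _).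
- apply: le_pr => //.
    apply: measurableI; [exact: mH|].
    exact: (mprop_outcome hA t (boundary e a) _ False l 0).
  move=> w [Hw [k [[[bk hk] Wk] kl]]]; split=> //=.
  have aE : A t w = a by exact: Hw.
  rewrite /= aE in bk hk.
  apply: (@outcome_first _ _ _ _ l 0%N _ k) => // i ik bi.
  by have := hk i bi; rewrite leqNgt ik.
- by move=> _ x; exact: descent_ge0.
- by move=> _ x _ /= xm; rewrite descent_low.
- by [].
- by move=> _ x ax; exact: descent_super.
- by move=> v; rewrite descent_high.
Qed.

(** The comparison with the functions of [survival_vanish], for all [eps]. *)
Lemma history_never_hits t w0 : pr (history A t w0 `&` never_hits t) = 0.
Proof.
have aM := heightP hA t w0; have a0 := aggregate_layer0 hA t w0.
have mI : measurable (history A t w0 `&` never_hits t).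
  by apply: measurableI; [exact: mH|exact: measurable_never_hits].
apply/eqP; rewrite eq_le pr_ge0 andbT; apply/ler_addgt0Pl => eps eps0.
rewrite addr0.
have [phi [phi0 phi1 phiS [l hl]]] := survival_vanish hG hd V0 aM a0 eps0.
apply: (@le_trans _ _ (pr (history A t w0) * eps)); last first.
  by rewrite ler_piMl ?(ltW eps0) // pr_le1 //; exact: mH.
apply: le_trans (outcome_history_le hd hA (T := set0) (b := True)
  (phi := phi) phi0 _ _ phiS hl).
- apply: le_pr => //.
    apply: measurableI; [exact: mH|].
    exact: (mprop_outcome hA t (boundary e (A t w0)) _ True l 0).
  move=> w [Hw nw]; split=> //=; apply: outcome_never => // i.
  by have := nw i; rewrite (Hw t (leqnn t)).
- by [].
- by move=> _ x; rewrite phi1.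
Qed.

(** Some [v] has an aggregate vertex right below [(v, M)], with [M] the height.
    A walk that starts at [(v, M)], which has probability [1 / #|V|], sticks at
    once and occupies the layer [M]. *)
Lemma history_height_stuck t w0 :
  pr (history A t w0 `&` [set w | (height t.+1 w <= height t w0)%N]) <=
  (1 - #|V|%:R^-1) * pr (history A t w0).
Proof.
have aM := heightP hA t w0; set M := height t w0 in aM *.
set a := A t w0 in aM *.
have [j MjE] : exists j, M = j.+1.
  by exists M.-1; rewrite prednK // (height_gt0 V0 aM (aggregate_layer0 hA t w0)).
have [v av] := aM.1 j (eq_ind_r (fun i => (j < i)%N) (ltnSn j) MjE).
have mS : measurable [set w | W t.+1 0%N w = (v, M)].
  exact: mprop_walk_eq hA t 0%N (v, M).
have H := mH t w0.
rewrite mulrBl mul1r lerBrDr.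
rewrite [leRHS](pr_split P H mS) addrC; apply: lerD.
  by rewrite (pr_start hA) mulrC.
apply: le_pr.
- apply: measurableI => //; exact: (mprop_height t.+1 (fun h => (h <= M)%N)).
- by apply: measurableI => //; exact: measurableC.
move=> w [Hw hw]; split=> // /= WM.
have aE : A t w = a by exact: Hw.
have nav : ~ a (v, M) by move=> /(aM.2); rewrite ltnn.
have bW : boundary e (A t w) (W t.+1 0%N w).
  rewrite aE WM; split=> //; exists (v, j) => //.
  by rewrite /cyl_adj MjE /= !eqxx /= !orbT.
have A1 : A t.+1 w (v, M).
  have [[_ /(_ 0%N)]//|[k [_ hk] ->]] := aggregate_step hA t w.
  by right; have := hk _ bW; rewrite leqn0 => /eqP ->.
by have := (heightP hA t.+1 w).2 _ A1 => /=; rewrite ltnNge hw.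
Qed.

(** The aggregate is a finite set, so there are countably many histories up to
    time [t]; they are coded by natural numbers to sum over them. *)
Lemma sum_histories t (Q : set (V * nat) -> Prop) (B : set Omega) (c : R) :
  0 <= c -> measurable B ->
  (forall w0, Q (A t w0) ->
     pr (history A t w0 `&` B) <= c * pr (history A t w0)) ->
  pr ([set w | Q (A t w)] `&` B) <= c * pr [set w | Q (A t w)].
Proof.
move=> c0 mB hB.
pose code w : nat := choice.pickle [seq fset_set (A s w) | s <- iota 0 t.+1].
have codeP w w' : code w = code w' -> forall s, (s <= t)%N -> A s w = A s w'.
  move=> /(pcan_inj choice.pickleK) h s st.
  apply: fset_set_inj; try exact: (aggregate_finite hA).
  have := congr1 (fun l => nth fset0 l s) h.
  by rewrite !(nth_map 0%N) ?size_iota ?ltnS // !nth_iota ?ltnS.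
pose F k := [set w | Q (A t w) /\ code w = k].
have F_cases k : F k = set0 \/ exists2 w0, Q (A t w0) & F k = history A t w0.
  have [[w0 [Q0 k0]]|nF] := pselect (exists w0, F k w0); [right|left].
    exists w0 => //; apply/seteqP; split=> w /=.
      by move=> [_ wk]; apply: codeP; rewrite wk k0.
    move=> h; split; first by rewrite h.
    rewrite -k0 /code; congr choice.pickle; apply/eq_in_map => s.
    by rewrite mem_iota ltnS => /andP[_ st]; rewrite h.
  by apply/seteqP; split=> // w Fw; apply: nF; exists w.
have mF k : measurable (F k).
  have [->//|[w0 _ ->]] := F_cases k; exact: mH.
have FU : [set w | Q (A t w)] = \bigcup_k F k.
  by apply/seteqP; split=> w; [move=> h; exists (code w)|move=> [k _ []]].
have tF : trivIset setT F.
  by apply/trivIsetP => i j _ _ ij; apply/seteqP; split=> // w [[_ wi] [_ wj]];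
    rewrite -wi -wj eqxx in ij.
have mQ : measurable [set w | Q (A t w)] by exact: mprop_aggregate hA t Q.
rewrite -lee_fin EFinM -!prE //; last exact: measurableI.
rewrite FU setI_bigcupl !measure_bigcup //; last 2 first.
- by move=> k _; exact: measurableI.
- by apply: trivIset_setIr.
rewrite -nneseriesZl //; apply: lee_nneseries => // k _.
have [->|[w0 Q0 ->]] := F_cases k; first by rewrite set0I !measure0 mule0.
have := hB _ Q0; rewrite -lee_fin EFinM -!prE //; first exact: mH.
by apply: measurableI => //; exact: mH.
Qed.

End HistorySums.


(** * Counting vertices in the lower layers *)
Section Counting.
Context (V : finType).
Implicit Types (S : set (V * nat)).

Definition count_below S m : nat :=
  (\sum_(1 <= i < m.+1) set_card (S `&` layer V i))%N.

Lemma set_card_layer S i :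
  set_card (S `&` layer V i) = #|[pred v | `[< S (v, i) >]]|.
Proof.
rewrite (set_card_seq (s := [seq (v, i) | v <- enum [pred v | `[< S (v, i) >]]])).
- by rewrite size_map -cardE.
- by rewrite map_inj_uniq ?enum_uniq // => ? ? [].
move=> [v j]; split=> [/mapP[u]|[Sv]].
  by rewrite mem_enum => /asboolW Su [-> ->]; split.
rewrite /layer /= => ji; rewrite ji in Sv *.
by apply/mapP; exists v; rewrite // mem_enum; exact/asboolP.
Qed.

Lemma count_below_le S S' m : (forall x, (x.2 <= m)%N -> S x -> S' x) ->
  (count_below S m <= count_below S' m)%N.
Proof.
move=> SS'; rewrite /count_below !big_nat; apply: leq_sum => i /andP[_ im].
rewrite !set_card_layer; apply: subset_leq_card; apply/fintype.subsetP => v.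
by move=> /asboolW Sv; apply/asboolP; exact: SS'.
Qed.

Lemma count_below_max S m : (count_below S m <= m * #|V|)%N.
Proof.
rewrite /count_below -[X in (_ <= X * _)%N]subn0 -(subSS 0 m) -sum_nat_const_nat.
by apply: leq_sum => i _; rewrite set_card_layer max_card.
Qed.

Lemma count_below_add S y m : ~ S y ->
  count_below (S `|` [set y]) m = (count_below S m + (0 < y.2 <= m)%N)%N.
Proof.
move=> Sy; rewrite /count_below.
transitivity (\sum_(1 <= i < m.+1) (set_card (S `&` layer V i) + (i == y.2)))%N.
  apply: eq_bigr => i _; rewrite !set_card_layer.
  case: eqP => [->|iy] /=.
    rewrite (cardD1 y.1) inE /= addnC.
    have -> : `[< (S `|` [set y]) (y.1, y.2) >] = true.
      by apply/asboolP; right; rewrite -surjective_pairing.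
    congr (_ + _)%N; apply: eq_card => v; rewrite !inE.
    case: eqP => [->|vy] /=.
      by apply/esym/asboolPn; rewrite -surjective_pairing.
    apply: asbool_equiv_eq; split=> [[//|/= E]|]; last by left.
    by exfalso; apply: vy; rewrite -E.
  rewrite addn0; apply: eq_card => v; rewrite !inE.
  apply: asbool_equiv_eq; split=> [[//|/= E]|]; last by left.
  by exfalso; apply: iy; rewrite -E.
rewrite big_split /=; congr (_ + _)%N.
under eq_bigr do rewrite -[X in nat_of_bool X]andbT.
transitivity (\sum_(1 <= i < m.+1 | i == y.2) 1)%N.
  by rewrite [RHS]big_mkcond; apply: eq_bigr => i _; rewrite andbT; case: (i == y.2).
by rewrite big_nat1_eq ltnS; case: (_ && _).
Qed.

Lemma count_below_layer0 m : count_below (layer V 0) m = 0%N.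
Proof.
rewrite /count_below big_nat big1 // => i /andP[i0 _].
by rewrite set_card_layer; apply: eq_card0 => v; rewrite !inE; apply/asboolPn;
  rewrite /layer /= => E; rewrite E in i0.
Qed.

End Counting.

(** * Late particles that land low *)
Section Expectations.
Context (V : finType) (e : rel V) (d : nat).
Hypotheses (hG : simple_connected_graph e) (hd : regular_graph e d).
Context (disp : measure_display) (Omega : measurableType disp) (R : realType).
Context (P : probability Omega R).
Context (A : nat -> Omega -> set (V * nat)) (W : nat -> nat -> Omega -> V * nat).
Hypothesis hA : cylinder_DLA P e A W.

Local Notation pr := (pr P).
Local Notation height := (height A).
Local Notation n := #|V|.

Let V0 : (0 < n)%N := card_vertices_gt0 P W.

Let n0 : 0 < n%:R :> R. Proof. by rewrite ltr0n. Qed.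

Let mheight t (Q : nat -> Prop) : measurable [set w | Q (height t w)].
Proof. exact: (mprop_height hA t Q). Qed.

Let mlow t m : measurable (lands_low e A W t m) := measurable_lands_low hA t m.

Let sum_heights t j (B : set Omega) c : 0 <= c -> measurable B ->
  (forall w0, height t w0 = j ->
     pr (history A t w0 `&` B) <= c * pr (history A t w0)) ->
  pr ([set w | height t w = j] `&` B) <= c * pr [set w | height t w = j].
Proof.
move=> c0 mB hB.
have -> : [set w | height t w = j] = [set w | has_height (A t w) j].
  apply/seteqP; split=> w /=; first by move=> <-; exact: heightP hA t w.
  exact: (height_eq hA).
apply: (sum_histories hA (Q := fun S => has_height S j)) => // w0 hw0.
by apply: hB; exact: (height_eq hA).
Qed.

Lemma height_le t w : (height t w <= t.+1)%N.
Proof.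
elim: t => [|t IH].
  by rewrite (height_eq hA (has_height_start hA w)).
have [[AE _]|[k [bk _] AE]] := aggregate_step hA t w.
  have -> : height t.+1 w = height t w.
    by apply: (height_eq hA); rewrite AE; exact: heightP hA t w.
  exact: leqW.
have := has_height_add (heightP hA t w) bk; rewrite -AE => /(height_eq hA) ->.
by case: ifP => _; rewrite ?ltnS // leqW.
Qed.

(** Each particle released from layer [j] raises the height with probability at
    least [1 / n]; hence the probability [G t] of a height at most [j] drops at
    step [t] by at least [1 / n] times the probability of the height [j].
    The sum of these drops is at most [1]. *)
Lemma expected_time_at_height j K :
  \sum_(t < K) pr [set w | height t w = j] <= n%:R.
Proof.
pose G t := pr [set w | (height t w <= j)%N].
have step t : pr [set w | height t w = j] <= n%:R * (G t - G t.+1).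
  rewrite mulrC -ler_pdivrMr // lerBrDr.
  set E := [set w | height t w = j].
  set B := [set w | (height t.+1 w <= j)%N].
  have mE : measurable E by exact: (mheight t (fun h => h = j)).
  have mB : measurable B by exact: (mheight t.+1 (fun h => (h <= j)%N)).
  have mG : measurable [set w | (height t w <= j)%N].
    exact: (mheight t (fun h => (h <= j)%N)).
  rewrite {1}/G -/B [leRHS](pr_split P mG mB) addrC; apply: lerD.
    apply: le_pr => //; first exact: measurableI.
    move=> w Bw; split=> //=; exact: leq_trans (height_nondec hA t w) Bw.
  have hstuck : pr (E `&` B) <= (1 - n%:R^-1) * pr E.
    apply: sum_heights => //.
      by rewrite subr_ge0 invf_le1 // ler1n.
    move=> w0 hw0; have := history_height_stuck hA t w0.
    by rewrite hw0.
  apply: (@le_trans _ _ (pr (E `&` ~` B))).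
    have := pr_split P mE mB; rewrite mulrBl mul1r in hstuck.
    rewrite mulrC; lra.
  apply: le_pr.
  - by apply: measurableI => //; exact: measurableC.
  - by apply: measurableI => //; exact: measurableC.
  - by move=> w [Ew nB]; split=> //=; rewrite Ew.
apply: (@le_trans _ _ (n%:R * (G 0%N - G K))).
  elim: K => [|K IH]; first by rewrite big_ord0 subrr mulr0.
  rewrite big_ord_recr /=; have := step K; lra.
have g1 : G 0%N <= 1 by apply: pr_le1; exact: (mheight 0%N (fun h => (h <= j)%N)).
have g0 : 0 <= G K by exact: pr_ge0.
by rewrite ler_piMr ?ler0n //; lra.
Qed.

Definition late_low m t : set Omega :=
  [set w | (m < height t w)%N] `&` lands_low e A W t m.

Lemma measurable_late_low m t : measurable (late_low m t).
Proof.
by apply: measurableI; [exact: (mheight t (fun h => (m < h)%N))|exact: mlow].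
Qed.

Local Notation rho := (descent_ratio R V d).

(** The sum of [n * rho ^ i]: in the mean at most [n] particles are released
    from the layer [m + 1 + i], and a fraction at most [rho ^ i] of them lands
    in the layer [m] or below. *)
Definition excess : R := n%:R / (1 - rho).

Lemma sum_late_low m K : \sum_(t < K) pr (late_low m t) <= excess.
Proof.
have r0 := @descent_ratio_gt0 R V d V0; have r1 := @descent_ratio_lt1 R V d V0.
(* The heights that exceed [m] and can occur before time [K]. *)
pose s := [seq (m + i).+1 | i <- iota 0 K].
have us : uniq s.
  by rewrite map_inj_uniq ?iota_uniq // => i j /eqP; rewrite eqSS eqn_add2l => /eqP.
have term t : (t < K)%N -> pr (late_low m t) <=
    \sum_(i < K) rho ^+ i * pr [set w | height t w = (m + i).+1].
  move=> tK.
  have mX y : measurable [set w | height t w = y] by exact: (mheight t (fun h => h = y)).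
  have sE : late_low m t `&` [set w | height t w \in s] = late_low m t.
    apply/seteqP; split=> w; first by case.
    move=> h; split=> //=; have [/= mh _] := h.
    apply/mapP; exists (height t w - m.+1)%N; last by rewrite -addSn subnKC.
    rewrite mem_iota add0n leq0n /= ltn_subLR // (leq_ltn_trans (height_le t w)) //.
    by rewrite addSn ltnS (leq_trans tK) // leq_addl.
  rewrite -sE (pr_seq P mX (measurable_late_low m t) us) big_map.
  have -> : iota 0 K = index_iota 0 K by rewrite /index_iota subn0.
  rewrite big_mkord; apply: ler_sum => i _.
  have -> : late_low m t `&` [set w | height t w = (m + i).+1] =
      [set w | height t w = (m + i).+1] `&` lands_low e A W t m.
    apply/seteqP; split=> w; first by move=> [[_ ?] ?].
    by move=> [/= E l]; split=> //; split=> //=; rewrite E ltnS leq_addr.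
  apply: sum_heights => //; first by rewrite exprn_ge0 // ltW.
  move=> w0 hw0; have mM : (m < height t w0)%N by rewrite hw0 ltnS leq_addr.
  have := history_lands_low hG hd hA mM.
  by rewrite hw0 /= addKn mulrC.
apply: (@le_trans _ _ (\sum_(t < K) \sum_(i < K)
    rho ^+ i * pr [set w | height t w = (m + i).+1])).
  by apply: ler_sum => t _; exact: term.
rewrite exchange_big /=.
apply: (@le_trans _ _ (\sum_(i < K) rho ^+ i * n%:R)).
  apply: ler_sum => i _; rewrite -mulr_sumr.
  by apply: ler_wpM2l; [rewrite exprn_ge0 // ltW|exact: expected_time_at_height].
rewrite -mulr_suml /excess mulrC ler_wpM2l ?ler0n //.
rewrite -[leRHS]mul1r ler_pdivlMr ?subr_gt0 // mulrC.
by rewrite -opprB mulNr -subrX1 opprB gerBl exprn_ge0 // ltW.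
Qed.

End Expectations.


(** * Reach times and densities in expectation *)
Section CountableValued.
Context (disp : measure_display) (Omega : measurableType disp) (R : realType).

Lemma measurable_fun_countable (I : countType) (f : Omega -> I) (g : I -> \bar R) :
  (forall i, mprop (fun w => f w = i)) -> measurable_fun [set: Omega] (g \o f).
Proof.
move=> mf _ Y _; rewrite setTI.
apply: (@mprop_ext _ _ (fun w => exists i, f w = i /\ Y (g i))).
  by move=> w; split=> [[i [<-]]//|h]; exists (f w).
by apply: mprop_ex => i; apply: mprop_and => //; exact: mprop_const.
Qed.

End CountableValued.

Section ReachTime.
Context (V : finType) (e : rel V) (d : nat).
Hypotheses (hG : simple_connected_graph e) (hd : regular_graph e d).
Context (disp : measure_display) (Omega : measurableType disp) (R : realType).
Context (P : probability Omega R).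
Context (A : nat -> Omega -> set (V * nat)) (W : nat -> nat -> Omega -> V * nat).
Hypothesis hA : cylinder_DLA P e A W.

Local Notation height := (height A).
Local Notation late_low := (late_low e A W).
Local Notation final := (final_aggregate A).

Lemma ae_hits : {ae P, forall w, forall t, ~ never_hits e A W t w}.
Proof.
apply: ae_foralln => t; exists (never_hits e A W t); split.
- exact: measurable_never_hits hA t.
- have mN := measurable_never_hits hA t.
  apply/eqP; rewrite eq_le measure_ge0 andbT.
  have := sum_histories hA (t := t) (Q := fun=> True) (lexx (0 : R)) mN.
  rewrite mul0r => h.
  have : pr P (never_hits e A W t) <= 0.
    have <- : [set w | True] `&` never_hits e A W t = never_hits e A W t.
      by apply/seteqP; split=> w // [].
    by apply: h => w0 _; rewrite mul0r (history_never_hits hG hd hA).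
  by rewrite -lee_fin -prE.
- by move=> w /= /contrapT.
Qed.

Lemma aggregate_boundary_low t w y : boundary e (A t w) y ->
  (0 < y.2)%N /\ (y.2 <= height t w)%N.
Proof.
move=> by_; split.
  by apply: (notin_height (aggregate_layer0 hA t w)) by_.1.
have := has_height_add (heightP hA t w) by_; case: ifP => [/eqP -> //|_ h].
by apply/ltnW; apply: (h.2 y); right.
Qed.

(** While layer [m] is empty, every particle lands in the layers
    [1, ..., m]: it sticks next to the aggregate, not higher than the first
    empty layer. *)
Lemma time_le_count m K w : (forall t, ~ never_hits e A W t w) ->
  (forall t, (t < K)%N -> (height t w <= m)%N) ->
  (K <= count_below (A K w) m)%N.
Proof.
move=> hits; elim: K => [//|K IH] hK.
have [[_ /hits]//|[k [bk _] ->]] := aggregate_step hA K w.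
have [y0 yh] := aggregate_boundary_low bk.
rewrite count_below_add ?bk.1 //; last by case: bk.
rewrite y0 (leq_trans yh) ?hK //= addn1 ltnS IH // => t tK.
by apply: hK; exact: leqW.
Qed.

(** Before [tau] each step adds at most one vertex; from [tau] on, a vertex added
    in the layers [1, ..., m] comes from a particle counted by [late_low]. *)
Lemma count_le_time m K w tau : (m < height tau w)%N ->
  (count_below (A K w) m <=
   minn K tau + \sum_(t < K) `[< late_low m t w >])%N.
Proof.
move=> mtau; have hmono s t : (s <= t)%N -> (height s w <= height t w)%N.
  elim: t => [|t IH]; first by rewrite leqn0 => /eqP ->.
  rewrite leq_eqVlt ltnS => /predU1P[->//|/IH]; move=> /leq_trans; apply.
  exact: height_nondec hA t w.
elim: K => [|K IH]; first by rewrite (dla_start hA) count_below_layer0.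
have mK : (minn K tau <= minn K.+1 tau)%N.
  by rewrite leq_min geq_minr andbT (leq_trans (geq_minl _ _)).
rewrite big_ord_recr /=.
have [[-> _]|[k hk ->]] := aggregate_step hA K w.
  by apply: (leq_trans IH); rewrite addnA -[X in (X <= _)%N]addn0 leq_add // leq_add2r.
rewrite count_below_add; last by case: hk => -[].
have [Ktau|tauK] := ltnP K tau.
  have -> : minn K.+1 tau = (minn K tau).+1.
    by rewrite (minn_idPl Ktau) (minn_idPl (ltnW Ktau)).
  apply: leq_trans (leq_add IH (leq_b1 _)) _.
  by rewrite addn1 addSn ltnS addnA leq_addr.
have [low|_] := boolP (0 < (W K.+1 k w).2 <= m)%N.
  have -> : `[< late_low m K w >] = true.
    apply/asboolP; split; first exact: leq_trans (hmono _ _ tauK).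
    by exists k; split=> //; case/andP: low.
  by rewrite addnA leq_add2r (leq_trans IH) // leq_add2r.
by rewrite addn0 (leq_trans IH) // addnA (leq_trans _ (leq_addr _ _)) // leq_add2r.
Qed.

(** The layers [0, ..., m] are finite, so there is a time after which nothing
    is added to them. *)
Lemma count_below_final m w : exists K0, forall K, (K0 <= K)%N ->
  count_below (A K w) m = count_below (final w) m.
Proof.
have /choice[T hT] : forall x : V * 'I_m.+1, exists t,
    final w (x.1, nat_of_ord x.2) -> A t w (x.1, nat_of_ord x.2).
  move=> x; have [[t _ At]|nf] := pselect (final w (x.1, nat_of_ord x.2)).
    by exists t.
  by exists 0%N => /nf.
exists (\max_x T x)%N => K hK; apply/eqP; rewrite eqn_leq; apply/andP; split.
  by apply: count_below_le => x _ Ax; exists K.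
apply: count_below_le => -[v i] /= im fx.
have := hT (v, Ordinal (im : (i < m.+1)%N)) fx => /=.
apply: (aggregate_nondec hA); apply: leq_trans hK.
exact: (leq_bigmax (v, Ordinal (im : (i < m.+1)%N))).
Qed.

Definition final_count m w : \bar R := (count_below (final w) m)%:R%:E.

Lemma measurable_final_count m : measurable_fun setT (final_count m).
Proof.
apply: (@measurable_fun_countable _ _ _ nat (fun w => count_below (final w) m)
  (fun k => k%:R%:E)) => j.
apply: (@mprop_ext _ _ (fun w => exists K0, forall K, (K0 <= K)%N ->
    count_below (A K w) m = j)).
  move=> w; have [K0 hK0] := count_below_final m w; split=> [[K1 hK1]|<-].
    by rewrite -(hK0 (maxn K0 K1)) ?leq_maxl // hK1 // leq_maxr.
  by exists K0.
apply: mprop_ex => K0; apply: mprop_all => K; apply: mprop_imp.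
  exact: mprop_const.
exact: (mprop_aggregate hA K (fun S => count_below S m = j)).
Qed.

Local Notation reach := (reach_time R A).

Lemma reach_time_first m w t : (m < height t w)%N ->
  (forall s, (m < height s w)%N -> (t <= s)%N) -> reach m w = t%:R%:E.
Proof.
move=> mt hs; apply/le_anti/andP; split.
  apply: ereal_inf_lbound; exists t => //=.
  by apply/(layer_meets _ (heightP hA t w)).
apply: le_ereal_inf_tmp => _ [s /= /(layer_meets _ (heightP hA s w)) ms <-].
by rewrite lee_fin ler_nat hs.
Qed.

Lemma reach_time_never m w : (forall t, (height t w <= m)%N) -> reach m w = +oo%E.
Proof.
move=> hm; rewrite /reach_time.
suff -> : [set t | A t w `&` layer V m !=set0] = set0.
  by rewrite image_set0 ereal_inf0.
apply/seteqP; split=> // t /= /(layer_meets _ (heightP hA t w)).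
by rewrite ltnNge hm.
Qed.

Lemma reach_time_ge0 m w : (0 <= reach m w)%E.
Proof. by apply: le_ereal_inf_tmp => _ [t _ <-]; rewrite lee_fin. Qed.

Lemma first_reach m w : (forall t, (height t w <= m)%N) \/
  exists2 t, (m < height t w)%N & forall s, (m < height s w)%N -> (t <= s)%N.
Proof.
have [ex|nex] := pselect (exists t, (m < height t w)%N).
  by right; exists (ex_minn ex); case: ex_minnP.
by left=> t; rewrite leqNgt; apply/negP => mt; apply: nex; exists t.
Qed.

(** The reach time is the infimum over [t] of functions of the height at [t]. *)
Lemma measurable_reach_time m : measurable_fun setT (reach m).
Proof.
pose u t w : \bar R := if (m < height t w)%N then t%:R%:E else +oo%E.
have mu t : measurable_fun setT (u t).
  apply: (@measurable_fun_countable _ _ _ nat (height t)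
    (fun h => if (m < h)%N then t%:R%:E else +oo%E)) => j.
  exact: (mprop_height hA t (fun h => h = j)).
suff -> : reach m = (fun w => einfs (u ^~ w) 0%N) by exact: measurable_fun_einfs.
apply/funext => w; apply/le_anti/andP; split.
  apply: le_ereal_inf_tmp => _ [t _ <-]; rewrite /u; case: ifP => [mt|_].
    apply: ereal_inf_lbound; exists t => //=.
    by apply/(layer_meets _ (heightP hA t w)).
  exact: leey.
apply: le_ereal_inf_tmp => _ [t /= /(layer_meets _ (heightP hA t w)) mt <-].
by apply: ereal_inf_lbound; exists t => //=; rewrite /u mt.
Qed.

Lemma expected_reach_le m :
  (\int[P]_w reach m w <= \int[P]_w final_count m w)%E.
Proof.
apply: ae_ge0_le_integral => //.
- by move=> w _; exact: reach_time_ge0.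
- exact: measurable_reach_time.
- by move=> w _; rewrite lee_fin.
- exact: measurable_final_count.
apply: filterS ae_hits => w hits _.
set N := count_below (final w) m.
have hN K : (count_below (A K w) m <= N)%N.
  by apply: count_below_le => x _ Ax; exists K.
have [hm|[t mt ht]] := first_reach m w.
  have := time_le_count (m := m) (K := N.+1) hits (fun t _ => hm t).
  by rewrite leqNgt ltnS hN.
rewrite (reach_time_first mt ht) lee_fin ler_nat.
apply: leq_trans (hN t); apply: time_le_count => // s st.
by rewrite leqNgt; apply/negP => /ht; rewrite leqNgt st.
Qed.

Lemma expected_count_le m :
  (\int[P]_w final_count m w <=
   \int[P]_w reach m w + (excess V d R)%:E)%E.
Proof.
pose f t w : \bar R := (\1_(late_low m t) w)%:E.
have f0 t w : (0 <= f t w)%E by rewrite lee_fin.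
have mf t : measurable_fun setT (f t).
  apply/measurable_EFinP/measurable_indic; exact: measurable_late_low hA m t.
have mN : measurable_fun setT (fun w => \sum_(t <oo) f t w)%E.
  by apply: (ge0_emeasurable_sum (P := xpredT)) => // t w _ _; exact: f0.
have N0 w : (0 <= \sum_(t <oo) f t w)%E by apply: nneseries_ge0.
apply: (@le_trans _ _ (\int[P]_w (reach m w + \sum_(t <oo) f t w))%E).
  apply: ge0_le_integral => //.
  - by move=> w _; rewrite lee_fin.
  - exact: measurable_final_count.
  - by apply: emeasurable_funD => //; exact: measurable_reach_time.
  move=> w _; have [hm|[t mt ht]] := first_reach m w.
    rewrite reach_time_never // addye ?leey //.
    by rewrite gt_eqF // (lt_le_trans _ (N0 w)) // ltNy0.
  rewrite (reach_time_first mt ht) /final_count.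
  have [K0 /(_ K0 (leqnn _)) <-] := count_below_final m w.
  apply: (@le_trans _ _ (t%:R%:E + (\sum_(0 <= s < K0) f s w))%E); last first.
    by rewrite leeD2l //; apply: nneseries_lim_ge => s _ _; exact: f0.
  rewrite big_mkord /f sumEFin -EFinD lee_fin.
  have := count_le_time K0 mt; rewrite -(ler_nat R) => /le_trans; apply.
  rewrite natrD lerD // ?ler_nat ?geq_minr // natr_sum.
  apply: ler_sum => s _; rewrite indicE; exact: lexx.
rewrite ge0_integralD //; last 2 first.
- by move=> w _; exact: reach_time_ge0.
- exact: measurable_reach_time.
rewrite leeD2l // integral_nneseries //.
apply: lime_le.
  by apply: is_cvg_nneseries => t _ _; exact: integral_ge0.
apply: nearW => K; rewrite big_mkord.
rewrite (eq_bigr (fun t : 'I_K => (pr P (late_low m t))%:E)); last first.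
  move=> t _; have mL := measurable_late_low hA m t.
  by rewrite integral_indic // setIT; exact: prE.
by rewrite sumEFin lee_fin; exact: (sum_late_low hG hd hA m K).
Qed.

Lemma densityE m w : (density R A m w)%:E =
  ((((m * #|V|)%N%:R)^-1)%:E * final_count m w)%E.
Proof. by rewrite /density -natr_sum. Qed.

Lemma density_itv m w : 0 <= density R A m w <= 1.
Proof.
rewrite /density -natr_sum -/(count_below _ m).
apply/andP; split; first by rewrite mulr_ge0 ?invr_ge0 ?ler0n.
have [->|mV] := posnP (m * #|V|)%N; first by rewrite invr0 mul0r.
rewrite mulrC ler_pdivrMr ?ltr0n // mul1r ler_nat; exact: count_below_max.
Qed.

Lemma measurable_density m : measurable_fun setT (fun w => (density R A m w)%:E).
Proof.
under eq_fun do rewrite densityE.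
apply: emeasurable_funM; first exact: measurable_cst.
exact: measurable_final_count.
Qed.

(** Dominated convergence: densities are at most [1]. *)
Lemma expected_density_cvg D : density_at_infinity P A D ->
  (\int[P]_w (density R A m w)%:E)%E @[m --> \oo] --> D%:E.
Proof.
move=> hD.
have [] := @dominated_convergence _ _ _ P setT measurableT
  (fun m w => (density R A m w)%:E) (cst D%:E) (cst 1%:E).
- exact: measurable_density.
- exact: measurable_cst.
- by apply: filterS hD => w hw _; apply: cvg_EFin => //; exact: nearW.
- exact: finite_measure_integrable_cst.
- apply: aeW => w m _; rewrite lee_fin ger0_norm; by case/andP: (density_itv m w).
move=> _ _; rewrite integral_cst //.
have P1 : (D%:E * P setT = D%:E)%E by rewrite probability_setT mule1.
by move=> cvD; rewrite -P1; exact: cvD.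
Qed.

Lemma scaled_excess_cvg :
  ((((m * #|V|)%N%:R)^-1)%:E * (excess V d R)%:E)%E @[m --> \oo] --> 0%E.
Proof.
rewrite -cvg_shiftS /=.
have -> : (fun m => ((((m.+1 * #|V|)%N%:R)^-1)%:E * (excess V d R)%:E)%E) =
   EFin \o (fun m => harmonic m * (#|V|%:R^-1 * excess V d R)).
  by apply/funext => m /=; rewrite -EFinM natrM invfM -mulrA.
apply: cvg_EFin; first exact: nearW.
rewrite -[X in _ --> X](mul0r (#|V|%:R^-1 * excess V d R)).
by apply: cvgMl; exact: cvg_harmonic.
Qed.

End ReachTime.

Theorem theorem4p2 (V : finType) (e : rel V) (d n : nat)
    (hG : simple_connected_graph e) (hd : regular_graph e d) (hn : #|V| = n)
    (disp : measure_display) (Omega : measurableType disp) (R : realType)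
    (P : probability Omega R)
    (A : nat -> Omega -> set (V * nat)) (W : nat -> nat -> Omega -> V * nat)
    (hA : cylinder_DLA P e A W)
    (D : R) (hD : density_at_infinity P A D) :
  ((((m * n)%N%:R)^-1)%:E * \int[P]_w reach_time R A m w)%E
    @[m --> \oo] --> D%:E.
Proof.
rewrite -{}hn.
pose c m : R := (m * #|V|)%N%:R^-1.
have c0 m : 0 <= c m by rewrite invr_ge0 ler0n.
have densI m : (\int[P]_w (density R A m w)%:E =
    (c m)%:E * \int[P]_w final_count R A m w)%E.
  under eq_integral do rewrite densityE.
  rewrite ge0_integralZl_EFin //; first by move=> w _; rewrite lee_fin.
  exact: measurable_final_count hA m.
have dens_cvg := expected_density_cvg hA hD.
apply: (@squeeze_cvge _ _ _ _
  (fun m => \int[P]_w (density R A m w)%:E - (c m)%:E * (excess V d R)%:E)%E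
  _ (fun m => \int[P]_w (density R A m w)%:E)%E _ _ _ dens_cvg).
  apply: nearW => m; apply/andP; split.
    rewrite densI leeBlDr // -muleDr //.
      by apply: lee_wpmul2l; [rewrite lee_fin|exact: (expected_count_le hG hd hA)].
    by rewrite fin_num_adde_defl.
  rewrite densI; apply: lee_wpmul2l; first by rewrite lee_fin.
  exact: (expected_reach_le hG hd hA).
rewrite -[X in _ --> X]sube0; apply: cvgeB => //.
exact: scaled_excess_cvg.
Qed.
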